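(* Let $p$ be a prime, let $n\geq 3$, and let $G$ be a $2$-generator $p$-group of nilpotency class $2$ of order $p^n$. Let $G$ be of exponent $p^e$. Assume that $K$ is any field satisfying either (i) $\operatorname{char} K=p>0$, or (ii) $\operatorname{char} K\neq p$ and $K$ contains a primitive $p^e$-th root of unity. Then $K(G)$ is rational over $K$.
   Context: For a field $K$ and a finite group $G$, let $G$ act on the rational function field $K(x(g):g\in G)$ (in $|G|$ independent variables) by $K$-automorphisms defined by $g\cdot x(h)=x(gh)$ for all $g,h\in G$; $K(G)$ denotes the fixed field $K(x(g):g\in G)^G$. A field extension $L$ of $K$ is called rational over $K$ if $L\simeq K(x_1,\ldots,x_m)$ over $K$ for some integer $m$, with $x_1,\ldots,x_m$ algebraically independent over $K$. *)

(* Defs.v *)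
From HB Require Import structures.
From mathcomp Require Import all_boot all_order all_fingroup all_algebra.
From mathcomp Require Import generic_quotient.
From mathcomp Require Export mpoly.

Set Implicit Arguments.
Unset Strict Implicit.
Unset Printing Implicit Defensive.

Import GRing.Theory.
Local Open Scope ring_scope.
Local Open Scope quotient_scope.

Local Notation "x %:F" := (@FracField.tofrac _ x).

Lemma tofrac_div (R : idomainType) (x : {fraction R}) :
  x = (\n_(repr x))%:F / (\d_(repr x))%:F.
Proof.
have d0 : (\d_(repr x))%:F != 0 by rewrite tofrac_eq0 denom_ratioP.
apply: (mulIf d0); rewrite divfK // -{1}(reprK x).
move: (repr x) => y.
unlock FracField.tofrac; rewrite -[LHS]FracField.pi_mul.
apply/eqmodP => /=.
by rewrite FracField.equivfE /FracField.mulf !numden_Ratio ?mulf_neq0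
  ?oner_neq0 ?denom_ratioP // !mulr1 mulrC.
Qed.

(* The extension to fraction fields of an injective ring morphism. *)
Definition frac_map (R S : idomainType) (f : R -> S) (x : {fraction R}) :
  {fraction S} := (f \n_(repr x))%:F / (f \d_(repr x))%:F.

Section FracMap.
Variables (R S : idomainType) (f : {rmorphism R -> S}).
Hypothesis f_inj : injective f.

Lemma frac_map_div (a b : R) : b != 0 ->
  frac_map f (a%:F / b%:F) = (f a)%:F / (f b)%:F.
Proof.
have nz c : c != 0 -> (f c)%:F != 0.
  by move=> c0; rewrite tofrac_eq0 -(rmorph0 f) (inj_eq f_inj).
move=> b0; rewrite /frac_map; set x := _ / _.
apply/eqP; rewrite eqr_div ?nz ?denom_ratioP // -!tofracM -!rmorphM tofrac_eq.
rewrite (inj_eq f_inj) -tofrac_eq !tofracM -eqr_div ?tofrac_eq0 ?denom_ratioP //.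
by rewrite -tofrac_div.
Qed.

Lemma frac_map_tofrac a : frac_map f a%:F = (f a)%:F.
Proof. by rewrite -[a%:F]divr1 -tofrac1 frac_map_div ?oner_neq0 // rmorph1 tofrac1 divr1. Qed.

Lemma frac_map_zmod_morphism : zmod_morphism (frac_map f).
Proof.
have nz c : c != 0 -> (f c)%:F != 0.
  by move=> c0; rewrite tofrac_eq0 -(rmorph0 f) (inj_eq f_inj).
move=> x y; rewrite [x]tofrac_div [y]tofrac_div.
have := denom_ratioP (repr y); have := denom_ratioP (repr x).
move: (\n_(repr x)) (\d_(repr x)) (\n_(repr y)) (\d_(repr y)) => a b c d b0 d0.
rewrite -mulNr addf_div ?tofrac_eq0 // -!tofracN -!tofracM -tofracD.
rewrite !frac_map_div ?mulf_neq0 // -mulNr addf_div ?nz //.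
by rewrite -!tofracN -!tofracM -tofracD !(rmorphM, rmorphD, rmorphN).
Qed.

Lemma frac_map_monoid_morphism : monoid_morphism (frac_map f).
Proof.
split; first by rewrite -tofrac1 frac_map_tofrac rmorph1.
move=> x y; rewrite [x]tofrac_div [y]tofrac_div.
have := denom_ratioP (repr y); have := denom_ratioP (repr x).
move: (\n_(repr x)) (\d_(repr x)) (\n_(repr y)) (\d_(repr y)) => a b c d b0 d0.
rewrite mulf_div -!tofracM !frac_map_div ?mulf_neq0 //.
by rewrite mulf_div -!tofracM !rmorphM.
Qed.
End FracMap.

Definition ratfun (K : fieldType) (n : nat) : fieldType :=
  {fraction {mpoly K[n]}}.

Definition ratfunC (K : fieldType) (n : nat) (c : K) : ratfun K n :=
  (c%:MP_[n])%:F.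
Arguments ratfunC {K} n c.

Lemma ratfunC_zmod_morphism (K : fieldType) n : zmod_morphism (@ratfunC K n).
Proof. by move=> c d; rewrite /ratfunC rmorphB tofracB. Qed.

Lemma ratfunC_monoid_morphism (K : fieldType) n :
  monoid_morphism (@ratfunC K n).
Proof. by split=> [|c d]; rewrite /ratfunC ?rmorph1 ?rmorphM ?tofrac1 ?tofracM. Qed.

HB.instance Definition _ (K : fieldType) n :=
  GRing.isZmodMorphism.Build K (ratfun K n) (@ratfunC K n)
    (@ratfunC_zmod_morphism K n).
HB.instance Definition _ (K : fieldType) n :=
  GRing.isMonoidMorphism.Build K (ratfun K n) (@ratfunC K n)
    (@ratfunC_monoid_morphism K n).

(* A field extension of K is a field L with an embedding [iota] of K into L. *)
Definition rational_over (K L : fieldType) (iota : {rmorphism K -> L}) : Prop :=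
  exists (m : nat) (phi : {rmorphism ratfun K m -> L}),
    bijective phi /\ forall c : K, phi (ratfunC m c) = iota c.

Section FixedField.
Variables (F : fieldType) (I : finType) (act : I -> {rmorphism F -> F}).

Definition fixed_by : {pred F} := [pred f | [forall g, act g f == f]].

Lemma fixed_byP f : reflect (forall g, act g f = f) (f \in fixed_by).
Proof. exact: 'forall_eqP. Qed.

Lemma fixed_by_divring_closed : divring_closed fixed_by.
Proof.
split=> [|x y /fixed_byP xf /fixed_byP yf|x y /fixed_byP xf /fixed_byP yf].
- by apply/fixed_byP => g; rewrite rmorph1.
- by apply/fixed_byP => g; rewrite rmorphB /= xf yf.
- by apply/fixed_byP => g; rewrite fmorph_div /= xf yf.
Qed.

HB.instance Definition _ :=
  GRing.isDivringClosed.Build F fixed_by fixed_by_divring_closed.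

Record fixed_field := FixedField {
  fixed_val : F;
  fixed_valP : fixed_val \in fixed_by }.

HB.instance Definition _ := [isSub for fixed_val].
HB.instance Definition _ := [Choice of fixed_field by <:].
HB.instance Definition _ := [SubChoice_isSubIntegralDomain of fixed_field by <:].
HB.instance Definition _ := [SubIntegralDomain_isSubField of fixed_field by <:].

End FixedField.

Section Noether.
Variables (K : fieldType) (G : finGroupType).

(* The variable x(h) is the one of index [enum_rank h]. *)
Definition noether_var (h : G) : ratfun K #|G| := ('X_(enum_rank h))%:F.

Definition noether_index (g : G) (i : 'I_#|G|) : 'I_#|G| :=
  enum_rank (g * enum_val i)%g.

Lemma noether_index_inj g : injective (noether_index g).
Proof. by move=> i j /enum_rank_inj /mulgI /enum_val_inj. Qed.

(* [msym s] substitutes 'X_(s i) for 'X_i, so g sends x(h) to x(gh): see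
   [noether_act_var]. *)
Definition noether_act (g : G) : ratfun K #|G| -> ratfun K #|G| :=
  frac_map (msym (perm (@noether_index_inj g))).

Lemma noether_act_zmod_morphism g : zmod_morphism (noether_act g).
Proof. exact/frac_map_zmod_morphism/inj_msym. Qed.

Lemma noether_act_monoid_morphism g : monoid_morphism (noether_act g).
Proof. exact/frac_map_monoid_morphism/inj_msym. Qed.

HB.instance Definition _ g :=
  GRing.isZmodMorphism.Build (ratfun K #|G|) (ratfun K #|G|) (noether_act g)
    (noether_act_zmod_morphism g).
HB.instance Definition _ g :=
  GRing.isMonoidMorphism.Build (ratfun K #|G|) (ratfun K #|G|) (noether_act g)
    (noether_act_monoid_morphism g).

Lemma noether_act_var g h : noether_act g (noether_var h) = noether_var (g * h)%g.
Proof.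
rewrite /noether_act /noether_var frac_map_tofrac; last exact: inj_msym.
by rewrite /= /msym mmapX mmap1U permE /noether_index enum_rankK.
Qed.

Lemma noether_actC g c : noether_act g (ratfunC _ c) = ratfunC _ c.
Proof.
rewrite /noether_act /ratfunC frac_map_tofrac; last exact: inj_msym.
by rewrite /= /msym mmapC.
Qed.

Definition noether_aut (g : G) : {rmorphism ratfun K #|G| -> ratfun K #|G|} :=
  noether_act g.

Definition noether_field : fieldType := fixed_field noether_aut.

Lemma noether_fixedC c : ratfunC #|G| c \in fixed_by noether_aut.
Proof. by apply/fixed_byP => g; apply: noether_actC. Qed.

Definition noetherC (c : K) : noether_field := FixedField (noether_fixedC c).

Lemma noetherC_zmod_morphism : zmod_morphism noetherC.
Proof. by move=> c d; apply: val_inj; rewrite /= rmorphB. Qed.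

Lemma noetherC_monoid_morphism : monoid_morphism noetherC.
Proof. by split=> [|c d]; apply: val_inj; rewrite /= ?rmorph1 ?rmorphM. Qed.

HB.instance Definition _ :=
  GRing.isZmodMorphism.Build K noether_field noetherC noetherC_zmod_morphism.
HB.instance Definition _ :=
  GRing.isMonoidMorphism.Build K noether_field noetherC noetherC_monoid_morphism.

End Noether.

(* Main.v *)
(** Let k be the image of K in F = K(x(g) : g in G).  Since F is algebraic over
    F^G and has transcendence degree |G|, Steinitz exchange shows that any |G|
    elements generating F^G over k are algebraically independent: only
    generation by |G| invariants has to be proved.  Miyata's theorem supplies
    them one at a time: if x is transcendental over a G-stable field L and each
    g maps x to a_g x + b_g with a_g, b_g in L, then L(x)^G = L^G(f).

    In characteristic p the regular representation of a p-group has a flag with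
    trivial quotients, so Miyata's theorem applies |G| times.

    Otherwise let G = <a, b>, c = [b, a] of order m, and A = <b, c, a^m>, an
    abelian normal subgroup of index m.  Let e_j be a basis of A-eigenvectors in
    the span of the x(h), h in A, with characters chi_j, and z_{j,i} = a^i e_j.
    Fix j1 such that w = chi_j1(c) has order m, put x_i = z_{j1,i}, and write
    chi_j(c) = w^k_j.  On z_{j,i} / x_i^k_j the element b acts by a scalar
    independent of i and a by a scaled cyclic shift, so a discrete Fourier
    transform over i yields m semi-invariants for each j <> j1.  When chi_j is
    the conjugate of chi_j1 by a, one of them is a y with a y = y and b y = w y.
    Then v_i = x_{i+1} / (x_i y) is fixed by b, a permutes v_0, ..., v_{m-1}
    cyclically, and their product is a constant over y^m, so that
    K(v, y)^G = K(v)^G, where the action on K(v) is diagonalised by a Fourier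
    transform.  The variables x_0 and the remaining semi-invariants are absorbed
    by Miyata's theorem. *)

Require Import Defs.
From mathcomp Require Import all_boot all_order all_algebra.
From mathcomp Require Import all_fingroup all_solvable.
From HB Require Import structures.
From mathcomp Require Import all_character.
From Stdlib Require Import ClassicalEpsilon.

Set Implicit Arguments.
Unset Strict Implicit.
Unset Printing Implicit Defensive.

Import GRing.Theory.
Local Open Scope ring_scope.

(** Classical truth values turn existential statements into predicates that can carry the closure
    structures of subrings and subfields. *)
Definition boolp (P : Prop) : bool :=
  if excluded_middle_informative P then true else false.

Lemma boolpP (P : Prop) : reflect P (boolp P).
Proof.
by rewrite /boolp; case: excluded_middle_informative => h; constructor.
Qed.

(** * Generated subfields and algebraic independence *)

Section Generated.
Variable F : fieldType.
Implicit Types (S : F -> Prop) (k : {pred F}) (s t : seq F).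

(** The clauses are those of [divring_closed], so this is the subfield generated by [S]; division by
    zero only adds zero. *)
Inductive gen_prop S : F -> Prop :=
  | GenBase x : S x -> gen_prop S x
  | GenOne : gen_prop S 1
  | GenSub x y : gen_prop S x -> gen_prop S y -> gen_prop S (x - y)
  | GenDiv x y : gen_prop S x -> gen_prop S y -> gen_prop S (x / y).

Definition gen S : {pred F} := fun x => boolp (gen_prop S x).

Lemma genP S x : reflect (gen_prop S x) (x \in gen S).
Proof. exact: boolpP. Qed.

Lemma gen_divring_closed S : divring_closed (gen S).
Proof.
split=> [|x y /genP xS /genP yS|x y /genP xS /genP yS]; apply/genP.
- exact: GenOne.
- exact: GenSub.
- exact: GenDiv.
Qed.

HB.instance Definition _ S :=
  GRing.isDivringClosed.Build F (gen S) (gen_divring_closed S).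

Lemma gen_base S x : S x -> x \in gen S.
Proof. by move=> Sx; apply/genP/GenBase. Qed.

Lemma gen_min S (D : divringClosed F) :
  (forall x, S x -> x \in D) -> {subset gen S <= D}.
Proof.
move=> SD x /genP; elim=> {x} [x /SD //||x y _ + _|x y _ + _].
- by rewrite rpred1.
- exact: rpredB.
- exact: rpred_div.
Qed.

Lemma gen_frac (R : subringClosed F) x : x \in gen (fun y => y \in R) ->
  exists r u, [/\ r \in R, u \in R, u != 0 & x = r / u].
Proof.
move/genP; elim=> {x} [x Rx||x y _ [r [u [Rr Ru u0 ->]]] _ [r' [u' [Rr' Ru' u0' ->]]]|
  x y _ [r [u [Rr Ru u0 ->]]] _ [r' [u' [Rr' Ru' u0' ->]]]].
- by exists x, 1; rewrite rpred1 oner_neq0 divr1.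
- by exists 1, 1; rewrite rpred1 oner_neq0 divr1.
- exists (r * u' - r' * u), (u * u').
  rewrite rpredB ?rpredM // mulf_neq0 //; split=> //.
  by rewrite -[- (r' / u')]mulNr addf_div // mulNr.
(* Division by zero yields zero, so a vanishing divisor needs a fraction of its own. *)
- have [->|r0] := eqVneq r' 0.
    by exists 0, 1; rewrite rpred0 rpred1 oner_neq0 !(mul0r, invr0, mulr0).
  exists (r * u'), (u * r'); rewrite !rpredM // mulf_neq0 //; split=> //.
  by rewrite invf_div mulf_div.
Qed.

Lemma common_denominator (R : subringClosed F) (p : {poly F}) :
    p \is a polyOver (gen (fun y => y \in R)) ->
  exists d, [/\ d \in R, d != 0 & d *: p \is a polyOver R].
Proof.
elim/poly_ind: p => [_|p c IHp]; first by exists 1; rewrite rpred1 oner_neq0 scaler0 rpred0.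
move=> Rp; have [d [Rd d0 Rdp]] : exists d, [/\ d \in R, d != 0 & d *: p \is a polyOver R].
  apply: IHp; apply/polyOverP => i; have /polyOverP/(_ i.+1) := Rp.
  by rewrite coefD coefMX coefC addr0.
have /gen_frac [r [u [Rr Ru u0 Ec]]] : c \in gen (fun y => y \in R).
  by have /polyOverP/(_ 0) := Rp; rewrite coefD coefMX coefC add0r.
exists (d * u); rewrite rpredM ?mulf_neq0 //; split=> //.
rewrite scalerDr rpredD // ?scalerAl.
  by rewrite rpredM ?polyOverX // mulrC -scalerA polyOverZ.
by rewrite -mul_polyC -polyCM polyOverC Ec -mulrA [u * _]mulrCA divff // mulr1 rpredM.
Qed.

Definition adj k s := gen (fun x => x \in k \/ x \in s).
HB.instance Definition _ k s := GRing.DivringClosed.on (adj k s).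

Lemma adj_base k s : {subset k <= adj k s}.
Proof. by move=> x kx; apply: gen_base; left. Qed.

Lemma adj_mem k s : {subset s <= adj k s}.
Proof. by move=> x sx; apply: gen_base; right. Qed.

Lemma adj_min k s (D : divringClosed F) :
  {subset k <= D} -> {subset s <= D} -> {subset adj k s <= D}.
Proof. by move=> kD sD; apply: gen_min => x [/kD|/sD]. Qed.

Lemma adjS k k' s s' :
    {subset k <= adj k' s'} -> {subset s <= adj k' s'} ->
  {subset adj k s <= adj k' s'}.
Proof. exact: adj_min. Qed.

Lemma adj_cat k s t : adj (adj k s) t =i adj k (s ++ t).
Proof.
move=> x; apply/idP/idP; move: x; apply: adj_min.
- apply: adj_min => x; first exact: adj_base.
  by move=> sx; apply: adj_mem; rewrite mem_cat sx.
- by move=> x tx; apply: adj_mem; rewrite mem_cat tx orbT.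
- by move=> x kx; do 2!apply: adj_base.
- move=> x; rewrite mem_cat => /orP[sx|tx]; last exact: adj_mem.
  exact/adj_base/adj_mem.
Qed.

Lemma adj_eqr k s t : s =i t -> adj k s =i adj k t.
Proof.
move=> st x; apply/idP/idP; move: x; apply: adjS => x; try exact: adj_base.
  by rewrite st; apply: adj_mem.
by rewrite -st; apply: adj_mem.
Qed.

Lemma adj_nil (k : divringClosed F) : adj k [::] =i k.
Proof.
by move=> x; apply/idP/idP; [apply: adj_min | apply: adj_base].
Qed.

End Generated.

(** * Subfields as fields, and division of polynomials over them *)

Section Subfield.
Variables (F : fieldType) (k : divringClosed F).

Record subfield := Subfield { subfield_val : F; subfield_valP : subfield_val \in k }.

HB.instance Definition _ := [isSub for subfield_val].
HB.instance Definition _ := [Choice of subfield by <:].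
HB.instance Definition _ := [SubChoice_isSubIntegralDomain of subfield by <:].
HB.instance Definition _ := [SubIntegralDomain_isSubField of subfield by <:].

Definition subfield_inj : subfield -> F := subfield_val.
HB.instance Definition _ := GRing.RMorphism.copy subfield_inj (val : subfield -> F).

Lemma polyOver_subfield p : p \is a polyOver k ->
  exists q : {poly subfield}, p = map_poly subfield_inj q.
Proof.
move=> kp; exists (\poly_(i < size p) Subfield (polyOverP kp i)).
apply/polyP => i; rewrite coef_map coef_poly.
by case: ltnP => // sp; rewrite nth_default.
Qed.

Lemma subfield_polyOver (q : {poly subfield}) : map_poly subfield_inj q \is a polyOver k.
Proof. by apply/polyOverP => i; rewrite coef_map; apply: subfield_valP. Qed.

(** Quotient and remainder do not change under field extension, so the division can be carried out
    over [subfield k]. *)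
Lemma polyOver_divp p q : p \is a polyOver k -> q \is a polyOver k ->
  (p %/ q \is a polyOver k) * (p %% q \is a polyOver k).
Proof.
move=> /polyOver_subfield[p' ->] /polyOver_subfield[q' ->].
by rewrite -map_divp -map_modp !subfield_polyOver.
Qed.

End Subfield.

(** * Algebraic elements, Steinitz exchange and independent lists *)

Section Algebraic.
Variable F : fieldType.
Implicit Types (k : {pred F}) (s t : seq F) (K : divringClosed F).

Definition alg k a := exists p : {poly F}, [/\ p \is a polyOver k, p != 0 & root p a].

Lemma algS k k' a : {subset k <= k'} -> alg k a -> alg k' a.
Proof.
by move=> kk' [p [kp p0 pa]]; exists p; split=> //; apply: (polyOverS kk' kp).
Qed.

Lemma alg_id K a : a \in K -> alg K a.
Proof.
by move=> Ka; exists ('X - a%:P); rewrite polyOverXsubC Ka polyXsubC_eq0 root_XsubC.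
Qed.

Lemma algE K a : alg K a <-> algebraicOver (subfield_inj (k:=K)) a.
Proof.
split=> [[p [/polyOver_subfield[q ->]]]|[q q0 qa]].
  by rewrite map_poly_eq0 => q0 qa; exists q.
by exists (map_poly (subfield_inj (k:=K)) q); rewrite subfield_polyOver map_poly_eq0.
Qed.

Definition algcl K : {pred F} := fun a => boolp (alg K a).

Lemma algclP K a : reflect (alg K a) (a \in algcl K).
Proof. exact: boolpP. Qed.

Lemma algcl_divring_closed K : divring_closed (algcl K).
Proof.
split=> [|x y /algclP/algE ax /algclP/algE ay|x y /algclP/algE ax /algclP/algE ay].
- by apply/algclP/alg_id/rpred1.
- by apply/algclP/algE/algebraic_sub.
- by apply/algclP/algE/algebraic_div.
Qed.

HB.instance Definition _ K :=
  GRing.isDivringClosed.Build F (algcl K) (algcl_divring_closed K).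

(** The coefficients of a polynomial over [adj K s] lie in the relative algebraic closure [algcl K],
    and a root of a polynomial with algebraic coefficients is algebraic. *)
Lemma alg_trans K s a : {in s, forall b, alg K b} -> alg (adj K s) a -> alg K a.
Proof.
move=> algs [p [Kp p0 pa]]; apply/algE/integral_algebraic.
apply: (integral_root p0 pa) => c pc; apply/integral_algebraic/algE/algclP.
have: c \in adj K s by move/all_nthP: Kp => Kp; move: pc => /(nthP 0)[i ip <-]; apply: Kp.
apply: adj_min => x; first by move=> Kx; apply/algclP/alg_id.
by move=> sx; apply/algclP/algs.
Qed.

Definition pevl k (a : F) : {pred F} :=
  fun x => boolp (exists2 p : {poly F}, p \is a polyOver k & x = p.[a]).

Lemma pevlP k a x :
  reflect (exists2 p : {poly F}, p \is a polyOver k & x = p.[a]) (x \in pevl k a).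
Proof. exact: boolpP. Qed.

Lemma pevl_subring_closed K a : subring_closed (pevl K a).
Proof.
split=> [|x y /pevlP[p Kp ->] /pevlP[q Kq ->]|x y /pevlP[p Kp ->] /pevlP[q Kq ->]];
  apply/pevlP.
- by exists 1; rewrite ?rpred1 ?hornerC.
- by exists (p - q); rewrite ?rpredB // hornerD hornerN.
- by exists (p * q); rewrite ?rpredM // hornerM.
Qed.

HB.instance Definition _ K a :=
  GRing.isSubringClosed.Build F (pevl K a) (pevl_subring_closed K a).

Lemma pevlC K a : {subset K <= pevl K a}.
Proof. by move=> c Kc; apply/pevlP; exists c%:P; rewrite ?polyOverC ?hornerC. Qed.

Lemma pevl_gen K a : a \in pevl K a.
Proof. by apply/pevlP; exists 'X; rewrite ?polyOverX ?hornerX. Qed.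

Lemma adj_pevl K a : {subset adj K [:: a] <= gen (fun y => y \in pevl K a)}.
Proof.
apply: adj_min => x; first by move=> Kx; apply/gen_base/pevlC.
by rewrite inE => /eqP->; apply/gen_base/pevl_gen.
Qed.

(** Cleared of denominators, an equation of [b] over [K(a)] becomes a relation in two variables.
    Read as a polynomial in [a], it has coefficients in [K[b]], not all zero because [b] is
    transcendental over [K]. *)
Lemma alg_exchange K a b : alg (adj K [:: a]) b -> ~ alg K b -> alg (adj K [:: b]) a.
Proof.
move=> [p [/(polyOverS (@adj_pevl K a)) Kp p0 pb]] tb.
have [d [_ d0 /polyOverP Kdp]] := common_denominator Kp.
set q := d *: p in Kdp.
have q0 : q != 0 by rewrite scaler_eq0 negb_or d0.
have qb : q.[b] = 0 by rewrite hornerZ (rootP pb) mulr0.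
have /fin_all_exists2[P KP EP] (i : 'I_(size q)) :
    exists2 r : {poly F}, r \is a polyOver K & q`_i = r.[a].
  exact/pevlP/Kdp.
pose D := \max_(i < size q) size (P i).
(* [r j] collects the coefficient of [a ^+ j], as a polynomial in the variable that stands for
   [b]. *)
pose r j := \sum_(i < size q) (P i)`_j *: 'X^i.
have Kr j : r j \is a polyOver K.
  by apply: rpred_sum => i _; rewrite polyOverZ ?rpredX ?polyOverX // (polyOverP (KP i)).
exists (\poly_(j < D) (r j).[b]); split.
- apply/polyOverP => j; rewrite coef_poly; case: ltnP => // _; last exact: rpred0.
  apply: rpred_horner; last exact/adj_mem/mem_head.
  by apply: polyOverS (Kr j); apply: adj_base.
- apply/eqP => /polyP E.
  (* The leading coefficient of a nonzero [P i] is a coefficient of [r j], where [j] is the degree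
     of [P i]. *)
  have [i Pi0] : exists i, P i != 0.
    have sq : ((size q).-1 < size q)%N by rewrite prednK ?size_poly_gt0.
    exists (Ordinal sq); apply: contraNneq q0 => /(congr1 (fun u => u.[a])).
    by rewrite -EP horner0 /= => /eqP; rewrite -lead_coefE lead_coef_eq0.
  have /eqP := E (size (P i)).-1; rewrite coef0 coef_poly.
  rewrite (leq_trans _ (leq_bigmax i)) ?prednK ?size_poly_gt0 // => rb.
  apply: tb; exists (r (size (P i)).-1); split=> //.
  apply/eqP => /polyP/(_ i); rewrite coef0 coef_sum (bigD1 i) //=.
  rewrite coefZ coefXn eqxx mulr1 big1 ?addr0 => [|i' i'i].
    by apply/eqP; rewrite -lead_coefE lead_coef_eq0.
  by rewrite coefZ coefXn eq_sym (negPf i'i : (_ == _ :> nat) = _) mulr0.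
- apply/eqP; rewrite horner_poly -[RHS]qb horner_coef.
  transitivity (\sum_(j < D) \sum_(i < size q) (P i)`_j * b ^+ i * a ^+ j).
    apply: eq_bigr => j _; rewrite /r horner_sum mulr_suml.
    by apply: eq_bigr => i _; rewrite hornerZ hornerXn.
  rewrite exchange_big; apply: eq_bigr => i _; rewrite EP /=.
  rewrite (@horner_coef_wide _ D _ a) ?(leq_bigmax i) // mulr_suml.
  by apply: eq_bigr => j _; rewrite mulrAC.
Qed.

(** The head is the element adjoined last. Over the constants this amounts to algebraic
    independence, by [indep_ev_eq0] and [ev_indep]. *)
Fixpoint indep k s :=
  if s is x :: s' then ~ alg (adj k s') x /\ indep k s' else True.

Lemma indep_cat k s t : indep k (s ++ t) -> indep (adj k t) s /\ indep k t.
Proof.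
elim: s => //= x s IHs [tx /IHs[ind indt]]; split=> //; split=> // ax; apply: tx.
apply: algS ax => y; rewrite adj_cat.
by rewrite (@adj_eqr _ _ _ (s ++ t)) // => z; rewrite !mem_cat orbC.
Qed.

(** Enlarging the ground field by [b] costs at most one entry. If only the head becomes algebraic,
    exchange makes [b] algebraic over the whole list. If a later entry is lost, [b] is already
    algebraic over [K(s)], so losing the head as well would make the head algebraic over [K(s)]. *)
Lemma indep_adjoin K b s : indep K s ->
  indep (adj K [:: b]) s \/
  alg (adj K s) b /\ exists s', [/\ {subset s' <= s}, size s = (size s').+1
    & indep (adj K [:: b]) s'].
Proof.
have swap t : adj (adj K [:: b]) t =i adj (adj K t) [:: b].
  by move=> x; rewrite !adj_cat; apply: adj_eqr => z; rewrite !mem_cat orbC.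
elim: s => [|a s IHs] /=; first by left.
have sas : {subset adj K s <= adj K (a :: s)}.
  by apply: adjS => x; [apply: adj_base | move=> sx; apply/adj_mem/mem_behead].
case=> ta /IHs[inds|[algb [s' [s's Es inds']]]].
  case: (boolpP (alg (adj (adj K [:: b]) s) a)) => [aa|]; last by left.
  right; split; last by exists s; split=> // x sx; rewrite inE sx orbT.
  have {}aa : alg (adj (adj K s) [:: b]) a.
    by apply: algS aa => x; rewrite swap.
  have := alg_exchange aa ta; apply: algS => x; rewrite adj_cat.
  by rewrite (@adj_eqr _ _ _ (a :: s)) // => z; rewrite mem_cat !inE orbC.
right; split; first exact: algS algb.
exists (a :: s'); split=> [x||/=]; last (split=> //).
- by rewrite !inE => /orP[->//|/s's->]; rewrite orbT.
- by rewrite /= Es.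
move=> aa; apply: ta; apply: (alg_trans (s := [:: b])) => [x|].
  by rewrite inE => /eqP->.
apply: algS aa => x; rewrite swap; move: x; apply: adjS => x; last exact: adj_mem.
move=> xs'; apply: adj_base; move: x xs'; apply: adjS => x; first exact: adj_base.
by move/s's; apply: adj_mem.
Qed.

(** Induction on [t], whose entries move one at a time into the ground field, each costing [s] at
    most one element. *)
Lemma indep_size K s t : indep K s -> {in s, forall x, alg (adj K t) x} ->
  (size s <= size t)%N.
Proof.
elim: t K s => [|b t IHt] K s ind algs.
  case/lastP: s ind algs => // s x; rewrite -cats1 => /indep_cat[_ /= [tx _]] algs.
  case: tx; apply: algS (algs x _) => [y|]; first by rewrite !adj_nil.
  by rewrite mem_cat mem_head orbT.
have algs' : {in s, forall x, alg (adj (adj K [:: b]) t) x}.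
  by move=> x /algs; apply: algS => y; rewrite adj_cat.
case: (indep_adjoin b ind) => [indb|[_ [s' [s's -> indb]]]].
  exact/leqW/(IHt _ _ indb).
by apply: (IHt _ _ indb) => x /s's/algs'.
Qed.

(** For a dependent [t] there would be a shorter list over which all of [t], hence all of [s], is
    algebraic, against [indep_size]. *)
Lemma indep_of_size K s t : indep K s -> {in s, forall x, alg (adj K t) x} ->
  (size t <= size s)%N -> indep K t.
Proof.
move=> ind algs ts; case: (boolpP (indep K t)) => // dep.
suff [t' [tt' algt]] : exists t', (size t').+1 = size t /\
    {in t, forall x, alg (adj K t') x}.
  suff : (size s <= size t')%N by move/(leq_trans ts); rewrite -tt' ltnn.
  apply: indep_size ind _ => x /algs ax.
  apply: (@alg_trans _ t _ algt); apply: algS ax; apply: adjS => y.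
    by move=> Ky; do 2!apply: adj_base.
  exact: adj_mem.
elim: t dep {ts algs} => //= x t IHt dep.
case: (boolpP (indep K t)) => [indt|/IHt[t' [tt' algt]]].
  exists t; split=> // y; rewrite inE => /orP[/eqP->|ty]; last exact/alg_id/adj_mem.
  by case: (boolpP (alg (adj K t) x)) => // ax; case: dep.
exists (x :: t'); rewrite /= tt'; split=> // y; rewrite inE => /orP[/eqP->|/algt].
  exact/alg_id/adj_mem/mem_head.
by apply: algS; apply: adjS => z; [apply: adj_base | move=> zt'; apply/adj_mem/mem_behead].
Qed.

End Algebraic.

(** * Invariants of affine actions *)

Section Miyata.
Variables (F : fieldType) (G : finGroupType) (act : G -> {rmorphism F -> F}).
Hypothesis act1 : forall x, act 1%g x = x.
Hypothesis actM : forall g h x, act (g * h)%g x = act g (act h x).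

Definition act_stable (D : {pred F}) := forall g x, x \in D -> act g x \in D.

Lemma actK g x : act g^-1%g (act g x) = x.
Proof. by rewrite -actM mulVg act1. Qed.

Lemma fixed_prod_act x : \prod_g act g x \in fixed_by act.
Proof.
apply/fixed_byP => h; rewrite rmorph_prod [RHS](reindex_inj (mulgI h)) /=.
by apply: eq_bigr => g _; rewrite actM.
Qed.

(** The orbit polynomial of [x] has invariant coefficients. *)
Lemma alg_fixed x : alg (fixed_by act) x.
Proof.
exists (\prod_g ('X - (act g x)%:P)); split.
- apply/polyOverP => i; apply/fixed_byP => h.
  rewrite -coef_map rmorph_prod; congr (polyseq _)`_i => /=.
  rewrite [RHS](reindex_inj (mulgI h)) /=; apply: eq_bigr => g _.
  by rewrite map_polyXsubC actM.
- by apply/prodf_neq0 => g _; rewrite polyXsubC_eq0.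
- apply/rootP; rewrite horner_prod (bigD1 1%g) //= act1.
  by rewrite hornerXsubC subrr mul0r.
Qed.

(** Multiplying by the other conjugates of the denominator replaces it by its norm, which is
    invariant; the numerator is then invariant too. *)
Lemma fixed_frac (R : subringClosed F) h : act_stable R ->
    h \in gen (fun y => y \in R) -> h \in fixed_by act ->
  exists r s, [/\ r \in [predI R & fixed_by act],
    s \in [predI R & fixed_by act], s != 0 & h = r / s].
Proof.
move=> stR /gen_frac[r [s [Rr Rs s0 Eh]]] fh.
have R' : \prod_(g | g != 1%g) act g s \in R by apply: rpred_prod => g _; apply: stR.
have Es : \prod_g act g s = s * \prod_(g | g != 1%g) act g s.
  by rewrite (bigD1 1%g) //= act1.
have n0 : \prod_g act g s != 0 by apply/prodf_neq0 => g _; rewrite fmorph_eq0.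
have Ehs : h * \prod_g act g s = r * \prod_(g | g != 1%g) act g s.
  by rewrite Es Eh mulrA divfK.
exists (h * \prod_g act g s), (\prod_g act g s); split=> //.
- apply/andP; split; first by rewrite Ehs rpredM.
  by rewrite rpredM ?fixed_prod_act.
- by apply/andP; rewrite fixed_prod_act Es rpredM.
- by rewrite mulfK.
Qed.

Section Step.
Variables (L : divringClosed F) (x : F).
Hypothesis stL : act_stable L.
Hypothesis tx : ~ alg L x.
Hypothesis actx : forall g, exists a b, [/\ a \in L, b \in L & act g x = a * x + b].

Lemma transc_eq p q : p \is a polyOver L -> q \is a polyOver L ->
  p.[x] = q.[x] -> p = q.
Proof.
move=> Lp Lq E; apply/eqP; rewrite -subr_eq0; case: (boolP (_ == 0)) => // n0.
case: tx; exists (p - q); split; rewrite ?rpredB //.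
by apply/rootP; rewrite hornerD hornerN E subrr.
Qed.

Lemma act_horner g p : p \is a polyOver L ->
  exists q, [/\ q \is a polyOver L, size q = size p & act g p.[x] = q.[x]].
Proof.
move=> Lp; have [a [b [La Lb E]]] := actx g.
(* If [a] vanished, [act g x] would lie in [L], and so would [x], by stability under the inverse of
   [g]. *)
have a0 : a != 0.
  apply/eqP => a0; apply: tx; apply: alg_id; rewrite -(actK g x) E a0 mul0r add0r.
  exact: stL.
exists (map_poly (act g) p \Po (a *: 'X + b%:P)); split.
- apply: polyOver_comp.
    by apply/polyOverP => i; rewrite coef_map stL // (polyOverP Lp).
  by rewrite rpredD ?polyOverZ ?polyOverX ?polyOverC.
- rewrite size_comp_poly2 ?size_map_poly //.
  by rewrite size_polyDl size_scale ?size_polyX // size_polyC; case: (b == 0).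
- by rewrite horner_comp !hornerE -E horner_map.
Qed.

Lemma pevl_stable : act_stable (pevl L x).
Proof.
move=> g _ /pevlP[p Lp ->]; have [q [Lq _ ->]] := act_horner g Lp.
by apply/pevlP; exists q.
Qed.

(** The norm of [x] is a product of [|G|] polynomials of degree 1 in [x]. *)
Lemma exists_fixed_poly : exists f : {poly F},
  [/\ f \is a polyOver L, f.[x] \in fixed_by act & (1 < size f)%N].
Proof.
have /fin_all_exists[q qP] g : exists q : {poly F},
    [/\ q \is a polyOver L, size q = 2 & act g x = q.[x]].
  have := act_horner g (polyOverX L); rewrite size_polyX hornerX.
  by case=> q [? ? ?]; exists q.
exists (\prod_g q g); split.
- by apply: rpred_prod => g _; case: (qP g).
- rewrite horner_prod (eq_bigr (fun g => act g x)) ?fixed_prod_act // => g _.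
  by case: (qP g).
- rewrite size_prod => [|g _]; last by rewrite -size_poly_gt0; case: (qP g) => _ ->.
  rewrite (eq_bigr (fun=> 2)) => [|g _]; last by case: (qP g).
  rewrite sum_nat_const muln2 -addnn -addSn addnK ltnS.
  by apply/card_gt0P; exists 1%g.
Qed.

(* Miyata: an invariant polynomial of least positive degree generates, because
   Euclidean division commutes with the action. *)
Lemma miyata : exists2 f, f \in fixed_by act & forall h,
  h \in adj L [:: x] -> h \in fixed_by act -> h \in adj [predI L & fixed_by act] [:: f].
Proof.
pose P n := boolp (exists f : {poly F},
  [/\ f \is a polyOver L, f.[x] \in fixed_by act, (1 < size f)%N & size f = n]).
have exP : exists n, P n.
  have [f [Lf ff sf]] := exists_fixed_poly.
  by exists (size f); apply/boolpP; exists f.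
have [_ /boolpP[f [Lf ff sf <-]] minf] := ex_minnP exP.
have f0 : f != 0 by rewrite -size_poly_gt0 (leq_trans _ sf).
exists f.[x] => // h hL hfix.
suff main r : r \in pevl L x -> r \in fixed_by act ->
    r \in adj [predI L & fixed_by act] [:: f.[x]].
  have [r [s [/andP[rR rf] /andP[sR sF] s0 ->]]] := fixed_frac pevl_stable (adj_pevl hL) hfix.
  by rewrite rpred_div // main.
move=> /pevlP[p Lp ->]; have [n] := ubnP (size p).
elim: n p Lp => // n IHn p Lp; rewrite ltnS => sp pfix.
have [small|big] := leqP (size p) 1.
  rewrite (size1_polyC small) hornerC in pfix *; apply: adj_base.
  by rewrite inE /= pfix (polyOverP Lp).
have sfp : (size f <= size p)%N by apply: minf; apply/boolpP; exists p.
have [Lq Lr] := polyOver_divp Lp Lf.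
have sr : (size (p %% f)%R < size f)%N by rewrite ltn_modp.
have sq : (size (p %/ f)%R < size p)%N.
  rewrite size_divp // ltn_subrL.
  by case: (size f) (size p) sf big => [|[|?]] [|?].
have Ep := divp_eq p f.
have inv g : act g (p %/ f).[x] = (p %/ f).[x] /\ act g (p %% f).[x] = (p %% f).[x].
  have [q' [Lq' _ Eq']] := act_horner g Lq.
  have [r' [Lr' sr' Er']] := act_horner g Lr.
  rewrite Eq' Er'; suff [-> ->] : q' = p %/ f /\ r' = p %% f by [].
  have {}Ep : p = q' * f + r'.
    apply: transc_eq => //; first exact: rpredD (rpredM Lq' Lf) Lr'.
    rewrite -[LHS](fixed_byP _ _ pfix g) [in LHS]Ep !(hornerD, hornerM) rmorphD rmorphM /=.
    by rewrite Eq' Er' (fixed_byP _ _ ff g).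
  have {}sr' : (size r' < size f)%N by rewrite sr'.
  by rewrite Ep divp_addl_mul_small ?modp_addl_mul_small.
rewrite Ep hornerD hornerM rpredD //; last first.
  apply: IHn => //; first exact: leq_trans sr (leq_trans sfp sp).
  by apply/fixed_byP => g; case: (inv g).
rewrite rpredM //; last exact/adj_mem/mem_head.
by apply: IHn => //; [exact: leq_trans sq sp | apply/fixed_byP => g; case: (inv g)].
Qed.
End Step.

(** As in [indep], the head is adjoined last, and it is moved affinely over the field generated by
    the tail. *)
Fixpoint affine_tower (L : {pred F}) (s : seq F) :=
  if s is x :: s' then
    (forall g, exists a b, [/\ a \in adj L s', b \in adj L s' & act g x = a * x + b])
    /\ affine_tower L s'
  else True.

Lemma adj_stable (L : {pred F}) s : act_stable L -> {in s, forall x g, act g x \in adj L s} ->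
  act_stable (adj L s).
Proof.
move=> stL sts g x /genP; elim=> {x} [x [Lx|sx]||x y _ + _|x y _ + _].
- exact/adj_base/stL.
- exact: sts.
- by rewrite rmorph1 rpred1.
- by rewrite rmorphB; apply: rpredB.
- by rewrite fmorph_div; apply: rpred_div.
Qed.

Lemma affine_tower_stable L s : act_stable L -> affine_tower L s -> act_stable (adj L s).
Proof.
move=> stL; elim: s => [_|x s IHs /= [aff /IHs st]]; first exact: adj_stable.
have sub : {subset adj L s <= adj L (x :: s)}.
  by apply: adjS => y; [apply: adj_base | move=> sy; apply/adj_mem/mem_behead].
apply: adj_stable => // y; rewrite inE => /orP[/eqP->|ys] g.
  have [a [b [/sub La /sub Lb ->]]] := aff g.
  by rewrite rpredD ?rpredM //; apply/adj_mem/mem_head.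
exact/sub/st/adj_mem.
Qed.

(** Miyata's theorem over [adj L s] adds one invariant for the head; the invariant coefficients it
    leaves lie in [adj L s] and are covered by induction. *)
Lemma miyata_tower (L : divringClosed F) s : act_stable L -> indep L s -> affine_tower L s ->
  exists t, [/\ size t = size s, {subset t <= fixed_by act} & forall h,
    h \in adj L s -> h \in fixed_by act -> h \in adj [predI L & fixed_by act] t].
Proof.
move=> stL; elim: s => [_ _|x s IHs /= [tx ind] [aff tow]].
  by exists [::]; split=> // h; rewrite adj_nil => Lh fh; apply: adj_base; rewrite inE Lh.
have [t [st tfix tP]] := IHs ind tow.
have [f ff fP] := miyata (affine_tower_stable stL tow) tx aff.
exists (f :: t); split=> [/=|y|h hL hf]; first by rewrite st.
  by rewrite inE => /orP[/eqP->|/tfix].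
have sub : {subset adj (adj [predI L & fixed_by act] t) [:: f] <=
    adj [predI L & fixed_by act] (f :: t)}.
  move=> y; rewrite adj_cat (@adj_eqr _ _ _ (f :: t)) // => z.
  by rewrite mem_cat !inE orbC.
apply: sub; have /fP/(_ hf) : h \in adj (adj L s) [:: x].
  by rewrite adj_cat (@adj_eqr _ _ _ (x :: s)) // => z; rewrite mem_cat !inE orbC.
apply: adjS => y; last exact: adj_mem.
by rewrite inE => /andP[Ly fy]; apply: adj_base; apply: tP.
Qed.

End Miyata.

(** * Rational function fields *)

Section LastVariable.
Variables (R : comNzRingType) (n : nat).
Local Notation widen := (widen_ord (leqnSn n)).

Lemma muniX (m : 'X_{1..n.+1}) :
  muni 'X_[R, m] = 'X_[[multinom (m (widen i)) | i < n]] *: 'X^(m ord_max).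
Proof. by rewrite muniE msuppX big_seq1 mcoeffX eqxx scale1r. Qed.

Lemma muni_mwiden (p : {mpoly R[n]}) : muni (mwiden p) = p%:P.
Proof.
elim/mpolyind: p => [|c m p _ _ IHp]; first by rewrite mwiden0 muni0.
rewrite mwidenD muniD IHp mwidenZ muniZ mwidenX muniX mnmwiden_ordmax expr0.
rewrite polyCD; congr (_ + _); rewrite -!mul_polyC mulr1 -polyCM mul_mpolyC.
by congr ((_ *: 'X_[_])%:P); apply/mnmP => i; rewrite mnmE mnmwiden_widen.
Qed.

Lemma muni_ord_max : muni ('X_ord_max : {mpoly R[n.+1]}) = 'X.
Proof.
rewrite muniX mnm1E eqxx expr1 (_ : [multinom _ | _ < _] = 0%MM) ?mpolyX0 ?scale1r //.
apply/mnmP => i; rewrite !mnmE; case: eqP => // /(congr1 val) /= E.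
by have := ltn_ord i; rewrite -E ltnn.
Qed.

(** Turns a polynomial in the last variable back into a multivariate one. *)
Definition mmul (q : {poly {mpoly R[n]}}) : {mpoly R[n.+1]} :=
  (map_poly (@mwiden n R) q).['X_ord_max].

Lemma mmulK : cancel mmul (@muni n R).
Proof.
move=> q; rewrite /mmul -horner_map /= muni_ord_max -map_poly_comp.
rewrite (eq_map_poly (g := polyC)) => [|p /=]; last exact: muni_mwiden.
by rewrite -/(q \Po 'X) comp_polyXr.
Qed.
End LastVariable.

(** * Evaluation of polynomials and algebraic independence *)

Section Evaluation.
Variables (K F : fieldType) (iota : {rmorphism K -> F}) (t : nat -> F).

Definition consts : {pred F} := gen (fun x => exists c, x = iota c).
HB.instance Definition _ := GRing.DivringClosed.on consts.

Lemma constsP x : reflect (exists c, x = iota c) (x \in consts).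
Proof.
apply: (iffP idP) => [/genP|]; last exact: gen_base.
elim=> {x} [x //||_ _ _ [c ->] _ [d ->]|_ _ _ [c ->] _ [d ->]].
- by exists 1; rewrite rmorph1.
- by exists (c - d); rewrite rmorphB.
- by exists (c / d); rewrite fmorph_div.
Qed.

(** The reversal puts the last member of the family at the head, where [indep] expects the element
    adjoined last. *)
Definition rseq n := rev (mkseq t n).

Lemma rseqS n : rseq n.+1 = t n :: rseq n.
Proof. by rewrite /rseq mkseqS rev_rcons. Qed.

Lemma mem_rseq n i : (i < n)%N -> t i \in rseq n.
Proof. by move=> ni; rewrite mem_rev map_f // mem_iota. Qed.

Definition ev n : {mpoly K[n]} -> F := mmap iota (fun i : 'I_n => t i).
HB.instance Definition _ n := GRing.RMorphism.on (@ev n).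

Lemma evC n c : ev (c%:MP_[n]) = iota c.
Proof. exact: mmapC. Qed.

Lemma evX n (m : 'X_{1..n}) : ev 'X_[m] = mmap1 (fun i : 'I_n => t i) m.
Proof. exact: mmapX. Qed.

Lemma ev_muni n (p : {mpoly K[n.+1]}) : ev p = (map_poly (@ev n) (muni p)).[t n].
Proof.
rewrite muniE rmorph_sum horner_sum /= /ev {1}/mmap; apply: eq_bigr => m _.
rewrite -mul_polyC -mul_mpolyC !rmorphM /= !map_polyC /= map_polyXn !hornerE. rewrite mmapC mmapX -mulrA.
congr (_ * _); rewrite /mmap1 big_ord_recr /=; congr (_ * _).
by apply: eq_bigr => i _; rewrite mnmE.
Qed.

Lemma ev_adj n (p : {mpoly K[n]}) : ev p \in adj consts (rseq n).
Proof.
apply: rpred_sum => m _; rewrite rpredM //.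
  by apply/adj_base/constsP; exists p@_m.
by apply: rpred_prod => i _; rewrite rpredX //; apply/adj_mem/mem_rseq.
Qed.

(** Induction on [n]: when [p] is viewed as univariate in the last variable, the values of its
    coefficients vanish, [t n] being transcendental over the earlier members. *)
Lemma indep_ev_eq0 n : indep consts (rseq n) -> forall p : {mpoly K[n]}, ev p = 0 -> p = 0.
Proof.
elim: n => [_ p|n IHn].
  rewrite (nvar0_mpolyC p) evC => /eqP; rewrite fmorph_eq0 => /eqP->.
  by rewrite mpolyC0.
rewrite rseqS /= => -[tn /IHn inj] p; rewrite ev_muni => pt.
have E : muni p = 0.
  apply/polyP => i; rewrite coef0; apply: inj.
  have /polyP/(_ i) : map_poly (@ev n) (muni p) = 0; last by rewrite coef_map coef0.
  apply/eqP; case: (boolP (_ == 0)) => // p0; case: tn.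
  exists (map_poly (@ev n) (muni p)); split=> //; last exact/rootP.
  by apply/polyOverP => j; rewrite coef_map; apply: ev_adj.
(* What remains is to see, monomial by monomial, that [mmul (muni p)] is [p]. *)
have : mmul (muni p) = 0 by rewrite E /mmul map_poly0 horner0.
rewrite muniE /mmul rmorph_sum horner_sum /= => {}E.
rewrite [p]mpolyE -[RHS]E; apply: eq_bigr => m _.
rewrite -mul_polyC rmorphM /= map_polyC /= map_polyXn !hornerE mwidenZ mwidenX.
rewrite -scalerAl mpolyXn -mpolyXD; congr (_ *: 'X_[_]); apply/mnmP => i.
rewrite mnmDE mulmnE mnm1E.
case: (unliftP ord_max i) => [j ->|->]; last first.
  by rewrite mnmwiden_ordmax eqxx mul1n.
rewrite -[lift _ _]/(lift ord_max j) (negPf (neq_lift _ _)) mul0n addn0.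
have -> : lift ord_max j = widen_ord (leqnSn n) j by apply: val_inj; exact: lift_max.
by rewrite mnmwiden_widen mnmE.
Qed.

Definition evR n : {pred F} := fun x => boolp (exists p : {mpoly K[n]}, x = ev p).

Lemma evR_subring_closed n : subring_closed (evR n).
Proof.
split=> [|_ _ /boolpP[p ->] /boolpP[q ->]|_ _ /boolpP[p ->] /boolpP[q ->]]; apply/boolpP.
- by exists 1; rewrite rmorph1.
- by exists (p - q); rewrite rmorphB.
- by exists (p * q); rewrite rmorphM.
Qed.
HB.instance Definition _ n :=
  GRing.isSubringClosed.Build F (evR n) (evR_subring_closed n).

Lemma adj_evR n : {subset adj consts (rseq n) <= gen (fun y => y \in evR n)}.
Proof.
apply: adj_min => [_ /constsP[c ->]|x].
  by apply/gen_base/boolpP; exists c%:MP; rewrite evC.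
rewrite mem_rev => /mapP[i]; rewrite mem_iota => /= ni ->.
apply/gen_base/boolpP; exists 'X_(Ordinal ni).
by rewrite evX mmap1U.
Qed.

(** An equation of [t n] over the earlier members, cleared of denominators, lifts to a nonzero
    polynomial relation. *)
Lemma ev_indep n : (forall p : {mpoly K[n]}, ev p = 0 -> p = 0) -> indep consts (rseq n).
Proof.
elim: n => // n IHn inj; rewrite rseqS; split; last first.
  apply: IHn => p p0; apply: inj_mwiden; rewrite mwiden0; apply: inj.
  by rewrite ev_muni muni_mwiden map_polyC hornerC.
case=> p [/(polyOverS (@adj_evR n))/common_denominator[d [_ d0 /polyOverP Rp]] p0 pt].
have /fin_all_exists[q Eq] (i : 'I_(size (d *: p))) : exists r : {mpoly K[n]}, (d *: p)`_i = ev r.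
  exact/boolpP/Rp.
pose Q := \sum_i (q i)%:P * 'X^i.
have EQ : map_poly (@ev n) Q = d *: p.
  rewrite rmorph_sum /= -[RHS]coefK poly_def; apply: eq_bigr => i _.
  by rewrite rmorphM /= map_polyC map_polyXn /= mul_polyC Eq.
have Q0 : Q = 0.
  rewrite -(mmulK Q) [mmul Q]inj ?muni0 // ev_muni mmulK EQ hornerZ.
  by rewrite (rootP pt) mulr0.
by move/eqP: EQ; rewrite Q0 map_poly0 eq_sym scaler_eq0 (negPf d0) (negPf p0).
Qed.
End Evaluation.

(** * Rational function fields from injective evaluations *)

Section Lift.
Variables (K L : fieldType) (iota : {rmorphism K -> L}) (n : nat) (t : 'I_n -> L).
Hypothesis inj : forall p : {mpoly K[n]}, mmap iota t p = 0 -> p = 0.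

Local Notation e := (mmap iota t).

Lemma mmap_injective : injective e.
Proof.
move=> p q E; apply/eqP; rewrite -subr_eq0; apply/eqP/inj.
by rewrite rmorphB /= E subrr.
Qed.

Definition lift_ratfun (x : ratfun K n) : L :=
  e \n_(generic_quotient.repr x) / e \d_(generic_quotient.repr x).

(** Embedding [L] into its own fraction field identifies [lift_ratfun] with [frac_map], so that the
    morphism laws carry over. *)
Lemma tofrac_lift x : @FracField.tofrac L (lift_ratfun x) = frac_map e x.
Proof. by rewrite /lift_ratfun fmorph_div. Qed.

Lemma tofrac_injective : injective (@FracField.tofrac L).
Proof. by move=> x y /eqP; rewrite tofrac_eq => /eqP. Qed.

Lemma lift_zmod_morphism : zmod_morphism lift_ratfun.
Proof.
move=> x y; apply: tofrac_injective.
have := frac_map_zmod_morphism (f := mmap iota t) mmap_injective x y.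
by rewrite -!tofrac_lift -tofracB.
Qed.

Lemma lift_monoid_morphism : monoid_morphism lift_ratfun.
Proof.
have [h1 hM] := frac_map_monoid_morphism (f := mmap iota t) mmap_injective.
split=> [|x y]; apply: tofrac_injective; first by rewrite tofrac_lift h1 tofrac1.
by have := hM x y; rewrite -!tofrac_lift -tofracM.
Qed.

HB.instance Definition _ :=
  GRing.isZmodMorphism.Build (ratfun K n) L lift_ratfun lift_zmod_morphism.
HB.instance Definition _ :=
  GRing.isMonoidMorphism.Build (ratfun K n) L lift_ratfun lift_monoid_morphism.

Lemma lift_tofrac p : lift_ratfun (@FracField.tofrac _ p) = e p.
Proof.
by apply: tofrac_injective; rewrite tofrac_lift frac_map_tofrac //; apply: mmap_injective.
Qed.

Lemma rational_over_mmap :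
    (forall x, exists p q, e q != 0 /\ x = e p / e q) -> rational_over iota.
Proof.
move=> surj; exists n, (lift_ratfun : {rmorphism _ -> _}); split=> [|c]; last first.
  by rewrite /= /ratfunC lift_tofrac mmapC.
have ex x : exists y, lift_ratfun y == x.
  have [p [q [q0 ->]]] := surj x; exists (@FracField.tofrac _ p / @FracField.tofrac _ q).
  by rewrite fmorph_div /= !lift_tofrac.
exists (fun x => xchoose (ex x)) => x; last exact/eqP/(xchooseP (ex x)).
apply: (fmorph_inj (lift_ratfun : {rmorphism _ -> _})).
exact/eqP/(xchooseP (ex _)).
Qed.
End Lift.

(** * Rationality of fixed fields by counting generators *)

Section FixedRational.
Variables (K F : fieldType) (G : finGroupType) (act : G -> {rmorphism F -> F}).
Hypothesis act1 : forall x, act 1%g x = x.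
Hypothesis actM : forall g h x, act (g * h)%g x = act g (act h x).
Variable (iota : {rmorphism K -> fixed_field act}).

Definition fixed_iota : K -> F := val \o iota.
HB.instance Definition _ := GRing.RMorphism.on fixed_iota.
Local Notation k := (consts fixed_iota).

(* Every element of F is algebraic over its G-invariants, so by counting a
   generating family of the right size is automatically independent. *)
Lemma rational_fixed_field s t : indep k s -> (size t <= size s)%N ->
  {subset t <= fixed_by act} -> {subset fixed_by act <= adj k t} ->
  rational_over iota.
Proof.
move=> ind st tfix tgen.
have indt : indep k t.
  apply: indep_of_size ind _ st => x _; apply: algS tgen _; exact: alg_fixed.
pose n := size t; pose u i := nth 0 (rev t) i.
have Et : t = rseq u n by rewrite /rseq /u /n -(size_rev t) mkseq_nth revK.
have ufix (i : 'I_n) : u i \in fixed_by act.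
  by apply: tfix; rewrite -mem_rev mem_nth // size_rev.
pose U i := FixedField (ufix i).
have EU p : val (mmap iota U p) = ev fixed_iota u p.
  rewrite /ev /mmap rmorph_sum; apply: eq_bigr => m _.
  rewrite rmorphM rmorph_prod; congr (_ * _); apply: eq_bigr => i _.
  by rewrite rmorphXn.
apply: (@rational_over_mmap _ _ _ n U) => [p p0|x].
  by apply: (indep_ev_eq0 (iota := fixed_iota) (t := u)); rewrite -?Et // -EU p0 rmorph0.
have /tgen : val x \in fixed_by act by apply: valP.
rewrite [in adj _ _]Et => /adj_evR/gen_frac[_ [_ [/boolpP[p ->] /boolpP[q ->] q0 E]]].
exists p, q; split.
  by apply: contraNneq q0 => q0; rewrite -EU q0 rmorph0.
by apply: val_inj; rewrite fmorph_div /= E -!EU.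
Qed.
End FixedRational.

Lemma rmorph_eq_gen (F : fieldType) (phi psi : {rmorphism F -> F}) (S : F -> Prop) :
  (forall x, S x -> phi x = psi x) -> {in gen S, phi =1 psi}.
Proof.
move=> eqS x /genP; elim=> {x} [x /eqS //||x y _ E _ E'|x y _ E _ E'].
- by rewrite !rmorph1.
- by rewrite !rmorphB /= E E'.
- by rewrite !fmorph_div /= E E'.
Qed.

(** * Linear forms with coefficients in the ground field *)

Section LinearForms.
Variables (K F : fieldType) (iota : {rmorphism K -> F}).
Local Notation k := (consts iota).

Definition lform n (X : 'I_n -> F) (v : 'rV[K]_n) : F := \sum_i iota (v 0 i) * X i.

Lemma lform_is_zmod_morphism n (X : 'I_n -> F) : zmod_morphism (lform X).
Proof.
move=> u v; rewrite /lform -sumrB; apply: eq_bigr => i _.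
by rewrite !mxE rmorphB mulrBl.
Qed.
HB.instance Definition _ n (X : 'I_n -> F) :=
  GRing.isZmodMorphism.Build 'rV[K]_n F (lform X) (lform_is_zmod_morphism X).

Lemma lformZ n (X : 'I_n -> F) c v : lform X (c *: v) = iota c * lform X v.
Proof. by rewrite mulr_sumr; apply: eq_bigr => i _; rewrite mxE rmorphM mulrA. Qed.

Lemma lform_delta n (X : 'I_n -> F) i : lform X (delta_mx 0 i) = X i.
Proof.
rewrite /lform (bigD1 i) //= mxE !eqxx rmorph1 mul1r big1 ?addr0 // => j ji.
by rewrite mxE eqxx (negPf ji) rmorph0 mul0r.
Qed.

Lemma lform_mul n m (X : 'I_n -> F) (v : 'rV_m) (M : 'M_(m, n)) :
  lform X (v *m M) = \sum_i iota (v 0 i) * lform X (row i M).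
Proof.
rewrite mulmx_sum_row raddf_sum; apply: eq_bigr => i _; exact: lformZ.
Qed.

Lemma rmorph_lform n (X Y : 'I_n -> F) (phi : {rmorphism F -> F}) v :
    (forall c, phi (iota c) = iota c) -> (forall i, phi (X i) = Y i) ->
  phi (lform X v) = lform Y v.
Proof.
move=> phiK phiX; rewrite rmorph_sum; apply: eq_bigr => i _.
by rewrite rmorphM /= phiK phiX.
Qed.

Lemma iota_consts c : iota c \in k.
Proof. by apply/constsP; exists c. Qed.
End LinearForms.

(** * The Noether action; characteristic p *)

Section NoetherSetup.
Variables (K : fieldType) (G : finGroupType).
Local Notation F := (ratfun K #|G|).
Local Notation act := (@noether_aut K G).
Local Notation iota := (@ratfunC K #|G|).
Local Notation k := (consts iota).
Local Notation X := (@noether_var K G).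

Local Notation tofrac := (@FracField.tofrac _).

Lemma tofrac_mpoly (p : {mpoly K[#|G|]}) : tofrac p =
  \sum_(m <- msupp p) iota p@_m * \prod_i X (enum_val i) ^+ m i.
Proof.
rewrite {1}[p]mpolyE rmorph_sum; apply: eq_bigr => m _.
rewrite /= -mul_mpolyC rmorphM mpolyXE_id rmorph_prod; congr (_ * _).
by apply: eq_bigr => i _; rewrite rmorphXn /noether_var enum_valK.
Qed.

Lemma noether_full t : (forall h, X h \in adj k t) -> forall f, f \in adj k t.
Proof.
move=> Xt f; rewrite [f]tofrac_div; set p := \n_ _; set q := \d_ _.
have in_t r : tofrac r \in adj k t.
  rewrite tofrac_mpoly; apply: rpred_sum => m _; rewrite rpredM //.
    exact/adj_base/iota_consts.
  by apply: rpred_prod => i _; rewrite rpredX.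
by rewrite rpred_div.
Qed.

Lemma noether_indep_vars : exists s, size s = #|G| /\ indep k s.
Proof.
(* The value 0 only serves indices beyond the order of [G], which [rseq] never reaches. *)
pose t i := oapp (fun j : 'I_#|G| => X (enum_val j)) 0 (insub i).
exists (rseq t #|G|); rewrite size_rev size_mkseq; split=> //.
apply: ev_indep => p; rewrite (_ : ev _ _ _ = tofrac p).
  by move/eqP; rewrite tofrac_eq0 => /eqP.
rewrite tofrac_mpoly; apply: eq_bigr => m _; congr (_ * _).
by apply: eq_bigr => i _; rewrite /t valK.
Qed.

(** The variables are [|G|] independent elements, algebraic over [adj k t], so [indep_of_size]
    applies. *)
Lemma noether_indep t : (size t <= #|G|)%N ->
  (forall h, alg (adj k t) (X h)) -> indep k t.
Proof.
move=> st algX; have [s [Es ind]] := noether_indep_vars; have {}st : (size t <= size s)%N by rewrite Es.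
apply: indep_of_size ind _ st => f _.
pose vs := [seq X h | h : G].
apply: (@alg_trans _ _ vs) => [_ /mapP[h _ ->] //|].
apply/alg_id; move: f; suff Xf f : f \in adj k vs.
  move=> f; have := Xf f; apply: adjS => y; last exact: adj_mem.
  by move=> ky; do 2!apply: adj_base.
by apply: noether_full => h; apply/adj_mem/map_f; rewrite mem_enum.
Qed.

Lemma noether_act1 f : act 1%g f = f.
Proof.
pose vs := [seq X h | h : G].
have : f \in adj k vs by apply: noether_full => h; apply/adj_mem/map_f; rewrite mem_enum.
apply: (rmorph_eq_gen (psi := idfun)) => {}f [/constsP[c ->]|/mapP[h _ ->]] /=.
  exact: noether_actC.
by rewrite noether_act_var mul1g.
Qed.

Lemma noether_actM g h f : act (g * h)%g f = act g (act h f).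
Proof.
pose vs := [seq X h | h : G].
have : f \in adj k vs by apply: noether_full => u; apply/adj_mem/map_f; rewrite mem_enum.
apply: (rmorph_eq_gen (psi := act g \o act h)) => {}f [/constsP[c ->]|/mapP[u _ ->]] /=.
  by rewrite !noether_actC.
by rewrite !noether_act_var mulgA.
Qed.

Lemma noether_rational t : (size t <= #|G|)%N -> {subset t <= fixed_by act} ->
    {subset fixed_by act <= adj k t} ->
  rational_over (@noetherC K G : {rmorphism K -> noether_field K G}).
Proof.
move=> st tfix tgen; have [s [Es ind]] := noether_indep_vars.
by apply: (rational_fixed_field noether_act1 noether_actM (s := s) (t := t)); rewrite ?Es.
Qed.

Lemma consts_stable : act_stable act k.
Proof. by move=> g _ /constsP[c ->]; rewrite /= noether_actC iota_consts. Qed.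

Lemma consts_fixed : [predI k & fixed_by act] =i k.
Proof.
move=> x; rewrite inE /=; case: constsP => //= -[c ->].
by apply/fixed_byP => g; apply: noether_actC.
Qed.

Lemma noether_rational_tower s : size s = #|G| -> affine_tower act k s ->
    (forall h, X h \in adj k s) ->
  rational_over (@noetherC K G : {rmorphism K -> noether_field K G}).
Proof.
move=> Es aff Xs.
have ind : indep k s by apply: noether_indep => [|h]; [rewrite Es | apply: alg_id].
have [t [st tfix tgen]] := miyata_tower noether_act1 noether_actM consts_stable ind aff.
apply: (@noether_rational t) => [||f ffix] //; first by rewrite st Es.
have := tgen f (noether_full Xs f) ffix; apply: adjS => y; last exact: adj_mem.
by rewrite consts_fixed; apply: adj_base.
Qed.

End NoetherSetup.

(** * Characteristic p: a flag of the regular representation *)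

Section CharP.
Variables (K : fieldType) (G : finGroupType) (p : nat).
Hypotheses (charK : p \in [pchar K]) (pG : (p.-group [set: G])%g).
Local Notation act := (@noether_aut K G).
Local Notation k := (consts (@ratfunC K #|G|)).
Local Notation X := (@noether_var K G).
Local Notation rG := (regular_repr K [set: G]%G).
Local Notation N := #|[set: G]|.

(* The regular representation of mathcomp acts by right translations, hence the inverse. *)
Definition cov : 'rV[K]_N -> ratfun K #|G| :=
  lform (@ratfunC K #|G|) (fun i => X (enum_val i)^-1%g).
HB.instance Definition _ := GRing.Additive.on cov.

Lemma cov_act g v : act g (cov v) = cov (v *m rG g^-1%g).
Proof.
rewrite /cov lform_mul; apply: rmorph_lform => [c|i]; first exact: noether_actC.
rewrite rowK lform_delta gring_indexK ?inE // invMg invgK.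
exact: noether_act_var.
Qed.

(** A p-group in characteristic p fixes a nonzero vector of any nonzero module, here of the quotient
    by [U]. Each [g] moves a lift [w] of it by an element of [U], so [cov w] is only translated over
    the field already built. *)
Lemma regular_flag d : (d <= N)%N -> exists (U : 'M[K]_N) s,
  [/\ mxmodule rG U, \rank U = d, size s = d, affine_tower act k s &
   forall v : 'rV_N, (v <= U)%MS -> cov v \in adj k s].
Proof.
elim: d => [_|d IHd dN].
  exists 0, [::]; split; rewrite ?mxmodule0 ?mxrank0 // => v.
  by rewrite submx0 => /eqP->; rewrite raddf0 rpred0.
have [U [s [modU rU ss aff cU]]] := IHd (ltnW dN).
have r0 : (0 < \rank (cokermx U))%N by rewrite mxrank_coker rU subn_gt0.
have := rfix_pgroup_pchar charK (factmod_repr modU) r0 pG (subxx _).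
set W := rfix_mx _ _ => W0; pose w0 := nz_row W.
have w00 : w0 != 0 by rewrite nz_row_eq0.
have /rfix_mxP fixw : (w0 <= W)%MS by apply: nz_row_sub.
pose w := val_factmod w0.
have wU : ~~ (w <= U)%MS by rewrite -in_factmod_eq0 val_factmodK.
have wJ g : (w *m rG g - w <= U)%MS.
  rewrite -in_factmod_eq0 raddfB /= (in_factmodJ modU) ?inE // val_factmodK.
  by rewrite [X in X - _](fixw g) ?inE // subrr.
exists (U + w)%MS, (cov w :: s); split.
- apply/mxmoduleP => g gG; rewrite addsmxMr addsmx_sub.
  rewrite (submx_trans (mxmoduleP modU g gG)) ?addsmxSl //.
  rewrite -[w *m _](subrK w) (addmx_sub (submx_trans (wJ g) _)) ?addsmxSl //.
  exact: addsmxSr.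
- rewrite -mxrank_in_factmod rU val_factmodK.
  by rewrite rank_rV w00.
- by rewrite /= ss.
- split=> // g; exists 1, (cov (w *m rG g^-1%g - w)); split; rewrite ?rpred1 ?cU //.
  by rewrite cov_act mul1r raddfB addrC subrK.
- move=> v /sub_addsmxP[[a b] /= ->]; rewrite raddfD /= rpredD //.
    have : cov (a *m U) \in adj k s by rewrite cU ?submxMl.
    by apply: adjS => y; [apply: adj_base | move=> sy; apply/adj_mem/mem_behead].
  rewrite [b]mx11_scalar mul_scalar_mx /cov lformZ rpredM //.
    exact/adj_base/iota_consts.
  exact/adj_mem/mem_head.
Qed.

Lemma noether_rational_pchar :
  rational_over (@noetherC K G : {rmorphism K -> noether_field K G}).
Proof.
have [U [s [_ rU ss aff cU]]] := regular_flag (leqnn N).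
apply: (noether_rational_tower _ aff) => [|h]; first by rewrite ss cardsT.
(* The double inverse matches the indexing of [cov] by inverses. *)
have {1}-> : h = (enum_val (gring_index [set: G] h^-1))^-1%g.
  by rewrite gring_indexK ?inE ?invgK.
rewrite -(lform_delta (@ratfunC K #|G|) (fun i => X (enum_val i)^-1%g)).
by apply: cU; apply: submx_full; rewrite /row_full rU.
Qed.
End CharP.

(** * Monomial actions with roots of unity *)

Section Fourier.
Variables (F : fieldType) (m : nat) (w : F).
Hypothesis wP : m.-primitive_root w.

Definition dft (f : nat -> F) l := \sum_(i < m) w ^- (l * i) * f i.

(** When [m] does not divide [i], multiplication by the nonzero [w ^+ i - 1] telescopes the
    geometric sum to zero. *)
Lemma sum_prim_root_exp i :
  \sum_(s < m) w ^+ (s * i) = if (m %| i)%N then m%:R else 0.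
Proof.
under eq_bigr => s _ do rewrite mulnC exprM.
rewrite (prim_order_dvd wP); case: eqP => [->|/eqP wi].
  under eq_bigr => s _ do rewrite expr1n.
  by rewrite sumr_const card_ord.
apply: (mulfI (x := w ^+ i - 1)); first by rewrite subr_eq0.
by rewrite -subrX1 mulr0 exprAC (prim_expr_order wP) expr1n subrr.
Qed.

Lemma dft_inv f i : (i < m)%N -> \sum_(l < m) w ^+ (l * i) * dft f l = m%:R * f i.
Proof.
move=> im; have w0 : w != 0 by rewrite (prim_root_eq0 wP) -lt0n (prim_order_gt0 wP).
under eq_bigr => l _ do rewrite mulr_sumr.
rewrite exchange_big (bigD1 (Ordinal im)) //= [X in _ + X]big1 ?addr0 => [|j ji].
  under eq_bigr => l _ do rewrite mulrA mulfV ?expf_neq0 // mul1r.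
  by rewrite sumr_const card_ord mulr_natl.
(* Negative exponents become natural ones through [w ^- (l * j) = w ^+ (l * (m - j))]. *)
have -> : \sum_(l < m) w ^+ (l * i) * (w ^- (l * j) * f j)
   = f j * \sum_(l < m) w ^+ (l * (i + (m - j))).
  rewrite mulr_sumr; apply: eq_bigr => l _; rewrite mulrA mulrC; congr (_ * _).
  rewrite mulnDr exprD; congr (_ * _).
  apply: (mulIf (expf_neq0 (l * j) w0)); rewrite mulVf ?expf_neq0 // -exprD -mulnDr.
  by rewrite subnK ?(ltnW (ltn_ord j)) // mulnC exprM (prim_expr_order wP) expr1n.
rewrite sum_prim_root_exp ifF ?mulr0 //; apply/negP => /dvdnP[q E].
case/eqP: ji; apply: val_inj => /=; have jm := ltn_ord j.
have {E} E : (i + m = q * m + j)%N by rewrite -E addnBA ?(ltnW jm) // subnK ?leq_addl // ltnW // ltn_addl.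
have := congr1 (fun u => (u %% m)%N) E.
by rewrite modnDr modnMDl !modn_small.
Qed.

Lemma sum_shift (f : nat -> F) : f m = f 0%N -> \sum_(i < m) f i.+1 = \sum_(i < m) f i.
Proof.
case: m (prim_order_gt0 wP) => // n _ E.
by rewrite big_ord_recr [RHS]big_ord_recl addrC /= E.
Qed.
End Fourier.

Lemma indep_neq0 (F : fieldType) (k : divringClosed F) s : indep k s -> {in s, forall x, x != 0}.
Proof.
elim: s => //= x s IHs [tx /IHs ind] y; rewrite inE => /orP[/eqP->|/ind //].
by apply/eqP => x0; apply: tx; rewrite x0; apply/alg_id/rpred0.
Qed.

Lemma indep_alg (F : fieldType) (k : divringClosed F) s b :
  indep k s -> alg k b -> indep (adj k [:: b]) s.
Proof.
move=> + kb; elim: s => //= x s IHs [tx /IHs ind]; split=> // ax; apply: tx.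
apply: (alg_trans (s := [:: b])) => [y|].
  by rewrite inE => /eqP->; apply: algS kb; apply: adj_base.
apply: algS ax => y; rewrite !adj_cat.
by rewrite (@adj_eqr _ _ _ (s ++ [:: b])) // => z; rewrite !mem_cat orbC.
Qed.

(** * The monomial action and its invariants *)

Section Monomial.
Variables (K F : fieldType) (iota : {rmorphism K -> F}) (G : finGroupType).
Variables (act : G -> {rmorphism F -> F}) (X : G -> F).
Local Notation k := (consts iota).
Hypothesis act1 : forall f, act 1%g f = f.
Hypothesis actM : forall g h f, act (g * h)%g f = act g (act h f).
Hypothesis actC : forall g c, act g (iota c) = iota c.
Hypothesis X_indep : forall t, (size t <= #|G|)%N ->
  (forall h, alg (adj k t) (X h)) -> indep k t.

Definition semi_invariant (L : {pred F}) (f : F) :=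
  forall g, exists2 c, c \in L & act g f = c * f.

Lemma semi_invariant_gen (L : divringClosed F) (a b : G) f c d :
    <<[set a; b]>>%g = [set: G] -> act_stable act L -> c \in L -> d \in L ->
  act a f = c * f -> act b f = d * f -> semi_invariant L f.
Proof.
move=> genG stL Lc Ld fa fb.
(* The elements that multiply [f] by a factor in [L] form a subgroup, by the cocycle rule for the
   factors. *)
pose H := [set g | boolp (exists2 c, c \in L & act g f = c * f)].
have gH : group_set H.
  apply/group_setP; split=> [|g h]; rewrite !inE.
    by apply/boolpP; exists 1; rewrite ?rpred1 // act1 mul1r.
  move=> /boolpP[r Lr Er] /boolpP[s Ls Es]; apply/boolpP; exists (r * act g s).
    by rewrite rpredM // stL.
  by rewrite actM Es rmorphM /= Er mulrCA mulrA.
have sub : [set: G] \subset Group gH.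
  rewrite -genG gen_subG; apply/subsetP => g; rewrite !inE => /orP[]/eqP->.
    by apply/boolpP; exists c.
  by apply/boolpP; exists d.
by move=> g; have /(subsetP sub) := in_setT g; rewrite inE => /boolpP.
Qed.

Lemma semi_invariant_tower (L : {pred F}) s :
  {in s, forall f, semi_invariant L f} -> affine_tower act L s.
Proof.
elim: s => //= f s IHs inv; split; last first.
  by apply: IHs => h hs; apply/inv/mem_behead.
move=> g; have [c Lc ->] := inv f (mem_head _ _) g.
by exists c, 0; rewrite addr0 rpred0; split=> //; apply: adj_base.
Qed.

Lemma semi_invariantS (L L' : {pred F}) f :
  {subset L <= L'} -> semi_invariant L f -> semi_invariant L' f.
Proof. by move=> LL' inv g; have [c /LL' Lc Ec] := inv g; exists c. Qed.

Lemma k_stable : act_stable act k.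
Proof. by move=> g _ /constsP[c ->]; rewrite actC iota_consts. Qed.

(* The vectors e j are eigenvectors of A = <b, c, a^m> with c = [b, a] of order m;
   their characters take the values beta j at b, w ^+ kappa j at c and gamma j at
   a^m.  The index j0 is that of the conjugate by a of the character of e j1. *)
Variables (a b : G) (m n : nat) (w : K) (e : 'I_n -> F).
Variables (beta gamma xi : 'I_n -> K) (kappa : 'I_n -> nat) (j0 j1 : 'I_n).
Hypothesis genG : <<[set a; b]>>%g = [set: G].
Hypothesis wP : m.-primitive_root w.
Hypothesis m_neq0 : m%:R != 0 :> K.
Hypothesis cardG : (m * n)%N = #|G|.

Definition translate j i := act (a ^+ i)%g (e j).
Local Notation z := translate.

Hypothesis act_b : forall j i, act b (z j i) = iota (beta j * w ^+ (kappa j * i)) * z j i.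
Hypothesis z_period : forall j i, z j (i + m) = iota (gamma j) * z j i.
Hypothesis X_z : forall h, X h \in adj k [seq z u.1 u.2 | u : 'I_n * 'I_m].
Hypothesis xiP : forall j, xi j ^+ m * gamma j1 ^+ kappa j = gamma j.
Hypothesis j01 : j0 != j1.
Hypothesis kappa1 : kappa j1 = 1%N.
Hypothesis kappa0 : kappa j0 = 1%N.
Hypothesis xi0 : xi j0 = 1.
Hypothesis beta0 : beta j0 = w * beta j1.

Let m_gt0 : (0 < m)%N. Proof. exact: prim_order_gt0 wP. Qed.
Let W := iota w.
Let WP : m.-primitive_root W. Proof. by rewrite /W fmorph_primitive_root. Qed.
Let mF_neq0 : m%:R != 0 :> F.
Proof. by rewrite -(rmorph_nat iota) fmorph_eq0. Qed.
Let o0 : 'I_m := Ordinal m_gt0.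

Lemma act_a j i : act a (z j i) = z j i.+1.
Proof. by rewrite /translate expgS (actM a (a ^+ i)%g). Qed.

(** The [|G|] elements [z j i] with [i < m] generate all variables, so they are independent, hence
    nonzero; this covers [e j] and so all its translates. *)
Lemma z_neq0 j i : z j i != 0.
Proof.
have ind : indep k [seq z u.1 u.2 | u : 'I_n * 'I_m].
  apply: X_indep => [|h]; last exact/alg_id/X_z.
  by rewrite size_image card_prod !card_ord -cardG mulnC.
have := indep_neq0 ind; rewrite fmorph_eq0 => /(_ (z j o0)).
by rewrite /translate expg0 act1; apply; apply/mapP; exists (j, o0); rewrite ?mem_enum ?expg0 ?act1.
Qed.

Let x i := z j1 i.

Lemma gamma_neq0 j : gamma j != 0.
Proof.
apply: contraTneq (z_neq0 j m) => g0; rewrite negbK.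
by rewrite -[m]add0n z_period g0 rmorph0 mul0r.
Qed.

Lemma xi_neq0 j : xi j != 0.
Proof.
apply: contraTneq (gamma_neq0 j) => x0.
by rewrite -xiP x0 expr0n (gtn_eqF m_gt0) mul0r eqxx.
Qed.

(* Dividing by a power of x i cancels the action of the commutator [b, a], so
   that a permutes the z' j i, up to scalars, and b multiplies them by a scalar
   which does not depend on i. *)
Let z' j i := z j i / x i ^+ kappa j.
(** Over one period [z' j] picks up [xi j ^+ m], by [xiP]; dividing by [xi j ^+ i] makes it
    periodic, as the Fourier transform requires. *)
Let f j i := iota (xi j) ^- i * z' j i.
Let y_ j l := dft m W (f j) l.

Lemma z'_period j i : z' j (i + m) = iota (xi j) ^+ m * z' j i.
Proof.
rewrite /z' /x !z_period exprMn invfM -xiP rmorphM !rmorphXn /=.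
have g0 : iota (gamma j1) ^+ kappa j != 0 by rewrite expf_neq0 // fmorph_eq0 gamma_neq0.
by rewrite mulrACA mulfK.
Qed.

Lemma f_period j i : f j (i + m) = f j i.
Proof.
rewrite /f z'_period exprD invfM -mulrA; congr (_ * _).
by rewrite mulKf // expf_neq0 // fmorph_eq0 xi_neq0.
Qed.

Lemma act_f g j i :
  act g (f j i) = iota (xi j) ^- i * (act g (z j i) / act g (x i) ^+ kappa j).
Proof. by rewrite /f /z' rmorphM fmorphV rmorphXn fmorph_div rmorphXn /= actC. Qed.

Lemma act_a_f j i : act a (f j i) = iota (xi j) * f j i.+1.
Proof.
rewrite act_f !act_a -/(z' j i.+1) /f exprS invfM -[in RHS]mulrA.
by rewrite mulVKf // fmorph_eq0 xi_neq0.
Qed.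

Lemma act_b_f j i : act b (f j i) = iota (beta j / beta j1 ^+ kappa j) * f j i.
Proof.
rewrite act_f /x !act_b.
have E (q r s t u : F) : q * (r * s / (t * u)) = r / t * (q * (s / u)).
  by rewrite -mulf_div mulrCA.
rewrite kappa1 mul1n exprMn E; congr (_ * _).
rewrite -(rmorphXn iota) -(fmorphV iota) -(rmorphM iota) /=; congr (iota _).
rewrite exprMn invfM -exprM [(kappa j * i)%N]mulnC mulrACA mulfV ?mulr1 //.
by rewrite expf_neq0 // (prim_root_eq0 wP) -lt0n.
Qed.

(** A scaled cyclic shift is diagonal in the Fourier basis: reindexing the sum by one step brings
    out [w ^+ l]. *)
Lemma act_a_dft (g : nat -> F) c l : (forall i, g (i + m)%N = g i) ->
  (forall i, act a (g i) = iota c * g i.+1) ->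
  act a (dft m W g l) = iota (c * w ^+ l) * dft m W g l.
Proof.
move=> gm ga; have w0 : W != 0 by rewrite (prim_root_eq0 WP) -lt0n.
rewrite /dft rmorph_sum /=.
rewrite -(sum_shift WP (f := fun i => W ^- (l * i) * g i)); last first.
  rewrite muln0 -[m in g m]add0n gm; congr (_^-1 * _).
  by rewrite mulnC exprM (prim_expr_order WP) expr1n.
rewrite mulr_sumr; apply: eq_bigr => i _.
rewrite (rmorphM (act a)) (fmorphV (act a)) (rmorphXn (act a)) /= actC ga rmorphM rmorphXn /= -/W.
rewrite mulnS exprD invfM -[RHS]mulrA -[in RHS]mulrA.
by rewrite mulVKf ?expf_neq0 // mulrCA.
Qed.

Lemma act_b_dft (g : nat -> F) c l : (forall i, act b (g i) = iota c * g i) ->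
  act b (dft m W g l) = iota c * dft m W g l.
Proof.
move=> gb; rewrite /dft rmorph_sum mulr_sumr; apply: eq_bigr => i _.
by rewrite (rmorphM (act b)) (fmorphV (act b)) (rmorphXn (act b)) /= actC gb mulrCA.
Qed.

Lemma semi_invariant_y j l : semi_invariant k (y_ j l).
Proof.
apply: (semi_invariant_gen genG k_stable) (act_a_dft _ (f_period j) (act_a_f j))
  (act_b_dft _ (act_b_f j)); exact: iota_consts.
Qed.

Lemma dft_adj (L : divringClosed F) (g : nat -> F) i : {subset k <= L} ->
  (forall l, (l < m)%N -> dft m W g l \in L) -> (i < m)%N -> g i \in L.
Proof.
move=> kL gL im; rewrite -(mulKf mF_neq0 (g i)) -(dft_inv WP _ im).
rewrite rpredM ?rpredV ?rpred_nat //; apply: rpred_sum => l _.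
by rewrite rpredM ?gL // rpredX // kL // iota_consts.
Qed.

Let y := y_ j0 0.

Lemma act_a_y : act a y = y.
Proof.
by rewrite (act_a_dft _ (f_period j0) (act_a_f j0)) xi0 mul1r expr0 rmorph1 mul1r.
Qed.

Lemma act_b_y : act b y = W * y.
Proof.
rewrite (act_b_dft _ (act_b_f j0)) kappa0 beta0 expr1 mulfK //.
apply: contraTneq (z_neq0 j1 0) => b0; rewrite negbK -(fmorph_eq0 (act b)).
by rewrite act_b b0 mul0r rmorph0 mul0r.
Qed.

Let v i := x i.+1 / (x i * y).
Let tt l := dft m W v l.

(** [z j i] is recovered from [x i] and [f j i], the latter by Fourier inversion from the
    [y_ j l]. *)
Lemma z_adj (L : divringClosed F) : {subset k <= L} ->
    (forall i, (i < m)%N -> x i \in L) ->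
    (forall j l, j != j1 -> (l < m)%N -> y_ j l \in L) ->
  forall j i, (i < m)%N -> z j i \in L.
Proof.
move=> kL xL yL j i im; have [->|jj1] := eqVneq j j1; first exact: xL.
have -> : z j i = iota (xi j) ^+ i * f j i * x i ^+ kappa j.
  rewrite mulVKf ?divfK ?expf_neq0 ?z_neq0 // fmorph_eq0; exact: xi_neq0.
have fL : f j i \in L by apply: (dft_adj (g := f j) _ _ im) => // l lm; apply: yL.
apply: rpredM; last by rewrite rpredX ?xL.
by apply: rpredM fL; rewrite rpredX ?(kL _ (iota_consts _ _)).
Qed.

Lemma X_adj (L : divringClosed F) : {subset k <= L} ->
  (forall j i, (i < m)%N -> z j i \in L) -> forall h, X h \in L.
Proof.
move=> kL zL h; have := X_z h; move: (X h); apply: adj_min => // _ /mapP[u _ ->].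
exact: zL.
Qed.

Let P := [pred u : 'I_n * 'I_m | u.1 != j1].
Let ylist (Q : pred ('I_n * 'I_m)) := [seq y_ u.1 u.2 | u : 'I_n * 'I_m in Q].

Lemma card_P : (m + #|P| = #|G|)%N.
Proof.
have := cardC P; rewrite card_prod !card_ord mulnC cardG => <-; rewrite addnC.
congr (_ + _)%N; rewrite -[LHS]card_ord -(card_image (f := fun i => (j1, i))); last first.
  by move=> i i' [].
apply: eq_card => -[j i]; rewrite !inE negbK.
by apply/mapP/eqP => [[i' _ [-> _]] //|/= ->]; exists i; rewrite ?mem_enum.
Qed.

Lemma mem_ylist (Q : pred ('I_n * 'I_m)) (u : 'I_n * 'I_m) : Q u -> y_ u.1 u.2 \in ylist Q.
Proof. by move=> Qu; apply/mapP; exists u => //; rewrite mem_enum. Qed.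

(** The [x i] and the [y_ j l] with [j != j1] are [|G|] elements generating all variables, so they
    are independent, and [y] is one of them. *)
Lemma y_neq0 : y != 0.
Proof.
have ind : indep k (mkseq x m ++ ylist P).
  apply: X_indep => [|h]; first by rewrite size_cat size_mkseq size_image card_P.
  apply/alg_id/X_adj; first exact: adj_base.
  apply: z_adj => [|i im|j l jj1 lm]; first exact: adj_base.
    by apply: adj_mem; rewrite mem_cat map_f // mem_iota.
  apply: adj_mem; rewrite mem_cat; apply/orP; right.
  exact: (mem_ylist (u := (j, Ordinal lm))).
apply: (indep_neq0 ind); rewrite mem_cat; apply/orP; right.
exact: (mem_ylist (u := (j0, o0))).
Qed.

Lemma act_a_v i : act a (v i) = v i.+1.
Proof. by rewrite /v fmorph_div rmorphM /= act_a_y /x !act_a. Qed.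

(** Under [b] both [x i.+1 / x i] and [y] gain the factor [w]. *)
Lemma act_b_v i : act b (v i) = v i.
Proof.
rewrite /v fmorph_div rmorphM /= act_b_y /x !act_b kappa1 !mul1n.
have w0 : w != 0 by rewrite (prim_root_eq0 wP) -lt0n.
have beta_neq0 : beta j1 != 0.
  apply: contraTneq (z_neq0 j1 0) => b0; rewrite negbK -(fmorph_eq0 (act b)).
  by rewrite act_b b0 mul0r rmorph0 mul0r.
have -> : iota (beta j1 * w ^+ i.+1) = iota (beta j1 * w ^+ i) * W.
  by rewrite exprSr mulrA rmorphM.
rewrite [X in _ / X]mulrACA -mulf_div divff ?mul1r //.
by rewrite mulf_neq0 ?fmorph_eq0 // mulf_neq0 ?expf_neq0.
Qed.

Lemma v_period i : v (i + m) = v i.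
Proof.
rewrite /v /x -addSn !z_period; have g0 := gamma_neq0 j1.
by rewrite -[_ * _ * y]mulrA -mulf_div divff ?mul1r // fmorph_eq0.
Qed.

Lemma prod_v r : \prod_(i < r) v i = x r / (x 0 * y ^+ r).
Proof.
elim: r => [|r IHr]; first by rewrite big_ord0 expr0 mulr1 divff // z_neq0.
rewrite big_ord_recr IHr /v /= mulf_div [x 0 * _ * _]mulrCA -mulf_div.
by rewrite divff ?z_neq0 // mul1r exprSr mulrA.
Qed.

Let T := mkseq tt m.
Let M := adj k T.
(** [y] is left out: it is algebraic over [M], and without it [R ++ T] has exactly [|G|] entries. *)
Let R := x 0 :: ylist [predD1 P & (j0, o0)].

Lemma v_M i : (i < m)%N -> v i \in M.
Proof.
move=> im; apply: (dft_adj (i := i) (L := M)) im => [|l lm]; first exact: adj_base.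
by apply: adj_mem; rewrite map_f // mem_iota.
Qed.

(** By periodicity the telescoping product of the [v i] over one period is [gamma j1] divided by
    [y ^+ m]. *)
Lemma y_expm_M : y ^+ m \in M.
Proof.
have E : \prod_(i < m) v i = iota (gamma j1) / y ^+ m.
  rewrite prod_v /x -[m in z j1 m]add0n z_period [z j1 0 * _]mulrC -mulf_div.
  by rewrite divff ?mulr1 ?z_neq0.
have -> : y ^+ m = iota (gamma j1) / \prod_(i < m) v i.
  rewrite E invf_div mulrC divfK // fmorph_eq0; exact: gamma_neq0.
rewrite rpred_div ?(adj_base _ (iota_consts _ _)) //.
by apply: rpred_prod => i _; apply: v_M.
Qed.

Lemma alg_y : alg M y.
Proof.
exists ('X^m - (y ^+ m)%:P); split.
- by rewrite rpredB ?rpredX ?polyOverX // polyOverC y_expm_M.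
- by rewrite -size_poly_eq0 size_XnsubC.
- by rewrite /root hornerD hornerN hornerXn hornerC subrr.
Qed.

Lemma z_LR (L : divringClosed F) : {subset M <= L} -> y \in L -> {subset R <= L} ->
  forall h, X h \in L.
Proof.
move=> ML yL RL; have kL : {subset k <= L} by move=> c kc; apply/ML/adj_base.
apply: X_adj => //; apply: z_adj => // [|j l jj1 lm].
  elim=> [_|i IHi im]; first exact/RL/mem_head.
  have iL := IHi (ltnW im); have -> : x i.+1 = v i * (x i * y).
    by rewrite divfK // mulf_neq0 ?y_neq0 ?z_neq0.
  by apply: rpredM; [exact/ML/v_M/ltnW | exact: rpredM].
have [E|ne] := eqVneq (j, Ordinal lm) (j0, o0).
  by case: E => -> ->.
apply/RL/mem_behead/(mem_ylist (u := (j, Ordinal lm))).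
by rewrite /= ne.
Qed.

Lemma size_RT : size (R ++ T) = #|G|.
Proof.
rewrite size_cat /= size_image size_mkseq -card_P [#|P|](cardD1 (j0, o0)).
by rewrite inE /= j01 addnC.
Qed.

(** Together with [y] the list generates all variables, and [y] is algebraic over [M], so the
    variables are algebraic over the field of [R ++ T]. *)
Lemma indep_RT : indep k (R ++ T).
Proof.
apply: X_indep => [|h]; first by rewrite size_RT.
have MRT : {subset M <= adj k (R ++ T)}.
  by apply: adjS => c; [apply: adj_base | move=> cT; apply: adj_mem; rewrite mem_cat cT orbT].
apply: (alg_trans (s := [:: y])) => [c|].
  by rewrite inE => /eqP->; apply: algS alg_y.
apply/alg_id/z_LR => [c /MRT||c cR]; first exact: adj_base.
  exact/adj_mem/mem_head.
by apply/adj_base/adj_mem; rewrite mem_cat cR.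
Qed.

Lemma tower_T : affine_tower act k T.
Proof.
apply: semi_invariant_tower => _ /mapP[l _ ->].
apply: (semi_invariant_gen genG k_stable (c := iota (1 * w ^+ l)) (d := iota 1)).
- exact: iota_consts.
- exact: iota_consts.
- by apply: (act_a_dft _ v_period) => i; rewrite rmorph1 mul1r act_a_v.
- by apply: act_b_dft => i; rewrite rmorph1 mul1r act_b_v.
Qed.

Lemma M_stable : act_stable act M.
Proof. exact: (affine_tower_stable k_stable tower_T). Qed.

Lemma act_b_M : {in M, forall f, act b f = f}.
Proof.
apply: (rmorph_eq_gen (psi := idfun)) => f' [/constsP[c ->]|/mapP[l _ ->]] /=.
  exact: actC.
have vb i : act b (v i) = iota 1 * v i by rewrite rmorph1 mul1r act_b_v.
by rewrite [LHS](act_b_dft _ vb) rmorph1 mul1r.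
Qed.

(* Averaging over the powers of b keeps only the powers of y^m. *)
Lemma pevl_b_fixed f' : f' \in pevl M y -> act b f' = f' -> f' \in M.
Proof.
move=> /pevlP[p Mp ->] bp.
have bpE : map_poly (act b) p = p.
  by apply/polyP => i; rewrite coef_map; apply/act_b_M/polyOverP.
have pW s : p.[W ^+ s * y] = p.[y].
  elim: s => [|s IHs]; first by rewrite mul1r.
  rewrite -[RHS]bp -IHs -horner_map bpE rmorphM rmorphXn /= act_b_y.
  by rewrite exprSr -mulrA [act b W]actC.
have : m%:R * p.[y] \in M.
  rewrite mulr_natl -[m in _ *+ m]card_ord -sumr_const.
  under eq_bigr => s _ do rewrite -(pW s) horner_coef.
  rewrite exchange_big; apply: rpred_sum => i _ /=.
  under eq_bigr => s _ do rewrite exprMn -exprM mulrCA mulrC.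
  rewrite -mulr_sumr sum_prim_root_exp //; case: ifP => [/dvdnP[q ->]|]; last first.
    by rewrite mulr0 rpred0.
  rewrite rpredM ?rpred_nat // rpredM ?(polyOverP Mp) //.
  by rewrite mulnC exprM rpredX // y_expm_M.
by move=> h; rewrite -(mulKf mF_neq0 p.[y]) rpredM ?rpredV ?rpred_nat.
Qed.

(** An invariant of [M(y)] is a quotient of invariants of the stable ring [M[y]], where
    [pevl_b_fixed] applies. *)
Lemma fixed_L0 f' : f' \in adj M [:: y] -> f' \in fixed_by act -> f' \in M.
Proof.
move=> /adj_pevl L0f fixf.
have stR : act_stable act (pevl M y).
  move=> g _ /pevlP[p Mp ->]; have [d kd Ed] := semi_invariant_y j0 0 g.
  apply/pevlP; exists (map_poly (act g) p \Po (d *: 'X)).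
    apply: polyOver_comp; last by rewrite polyOverZ ?polyOverX // adj_base.
    by apply/polyOverP => i; rewrite coef_map; apply/M_stable/polyOverP.
  by rewrite horner_comp hornerZ hornerX -Ed horner_map.
have [r [s [/andP[rR rf] /andP[sR sF] s0 ->]]] := fixed_frac act1 actM stR L0f fixf.
by rewrite rpred_div // pevl_b_fixed //; apply: fixed_byP.
Qed.

Lemma L0_stable : act_stable act (adj M [:: y]).
Proof.
apply: adj_stable M_stable _ => c; rewrite inE => /eqP-> g.
have [d kd ->] := semi_invariant_y j0 0 g.
rewrite rpredM //; last exact/adj_mem/mem_head.
exact/adj_base/adj_base.
Qed.

Lemma tower_R : affine_tower act (adj M [:: y]) R.
Proof.
have kL0 : {subset k <= adj M [:: y]} by move=> c kc; do 2!apply: adj_base.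
apply: semi_invariant_tower => c; rewrite inE => /orP[/eqP->|/mapP[u _ ->]]; last first.
  exact/(semi_invariantS kL0)/semi_invariant_y.
(* By definition of [v 0], [a] sends [x 0] to [x 1 = v 0 * y * x 0], whose factor lies in [M(y)] and
   need not be constant. *)
apply: (semi_invariant_gen genG L0_stable (c := v 0 * y)
  (d := iota (beta j1 * w ^+ (kappa j1 * 0)))) => //.
- by rewrite rpredM //; [exact/adj_base/v_M | exact/adj_mem/mem_head].
- exact/kL0/iota_consts.
- have h : x 0 * y != 0 by rewrite mulf_neq0 ?y_neq0 ?z_neq0.
  by rewrite [LHS]act_a -[v 0 * y * _]mulrA [y * _]mulrC divfK.
- exact: act_b.
Qed.

(** Two towers are stacked: [T] over the constants, then [R] over [M(y)]. Since the invariants of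
    [M(y)] lie in [M], the step from [M] to [M(y)] costs no generator. The first condition on [f]
    says that it lies in the field generated by the [X h]. *)
Lemma monomial_fixed : exists t, [/\ (size t <= #|G|)%N, {subset t <= fixed_by act} &
  forall f, (forall t, (forall h, X h \in adj k t) -> f \in adj k t) ->
    f \in fixed_by act -> f \in adj k t].
Proof.
have [indR indT] := indep_cat indep_RT.
have [t1 [s1 fix1 gen1]] := miyata_tower act1 actM k_stable indT tower_T.
have [t2 [s2 fix2 gen2]] :=
  miyata_tower act1 actM L0_stable (indep_alg indR alg_y) tower_R.
exists (t2 ++ t1); split=> [|c|g gfull gfix].
- by rewrite size_cat s1 s2 -size_cat size_RT.
- by rewrite mem_cat => /orP[/fix2|/fix1].
have gL : g \in adj (adj M [:: y]) R.
  have : g \in adj k (T ++ y :: R).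
    apply: gfull => h; apply: z_LR => [c||c cR].
    - by apply: adjS c => c; [apply: adj_base | move=> cT; apply: adj_mem; rewrite mem_cat cT].
    - by apply: adj_mem; rewrite mem_cat mem_head orbT.
    - by apply: adj_mem; rewrite mem_cat inE cR !orbT.
  move: g {gfull gfix}; apply: adj_min => c; first by move=> kc; do 3!apply: adj_base.
  rewrite mem_cat inE => /orP[cT|/orP[/eqP->|cR]]; last exact: adj_mem.
    exact/adj_base/adj_base/adj_mem.
  exact/adj_base/adj_mem/mem_head.
have := gen2 g gL gfix; apply: adjS => c; last first.
  by move=> ct; apply: adj_mem; rewrite mem_cat ct.
rewrite inE /= => /andP[/fixed_L0 Mc cfix].
have := gen1 c (Mc cfix) cfix; apply: adjS => d; first by case/andP=> kd _; apply: adj_base.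
by move=> dt; apply: adj_mem; rewrite mem_cat dt orbT.
Qed.

End Monomial.

(** * Class two groups with two generators *)

Section Eigenbasis.
Variables (K : fieldType) (gT : finGroupType) (A : {group gT}) (q : nat) (zeta : K).
Hypotheses (abA : abelian A) (expA : {in A, forall h, (h ^+ q)%g = 1%g}).
Hypothesis zetaP : q.-primitive_root zeta.

(** The matrix is annihilated by [X^q - 1], which splits with distinct roots, the powers of
    [zeta]. *)
Lemma repr_diagonalizable n (rG : mx_representation K A n.+1) h : h \in A ->
  diagonalizable (rG h).
Proof.
move=> Ah; apply/diagonalizableP; exists [seq zeta ^+ i | i <- iota 0 q].
  rewrite map_inj_in_uniq ?iota_uniq // => i j; rewrite !mem_iota /= => iq jq /eqP.
  by rewrite (eq_prim_root_expr zetaP) !modn_small // => /eqP.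
rewrite big_map -[iota 0 q](_ : index_iota 0 q = _) ?(factor_Xn_sub_1 zetaP); last first.
  by rewrite /index_iota subn0.
apply: mxminpoly_min; rewrite rmorphB rmorphXn /= horner_mx_X rmorph1.
by rewrite -(repr_mxX _ _ Ah) expA // repr_mx1 subrr.
Qed.

Lemma repr_eigenbasis n (rG : mx_representation K A n) :
  exists (P : 'M[K]_n) (chi : 'I_n -> gT -> K), P \in unitmx /\
    forall j h, h \in A -> row j P *m rG h = chi j h *: row j P.
Proof.
case: n rG => [|n] rG.
  by exists 1%:M, (fun _ _ => 0); split; rewrite ?unitmx1 // => -[].
have [P uP /allP Pdiag] : codiagonalizable [seq rG h | h in A].
  apply/codiagonalizableP; split=> [_ _ /mapP[h + ->] /mapP[h' + ->]|_ /mapP[h + ->]];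
    rewrite !mem_enum => Ah; last exact: repr_diagonalizable.
  by move=> Ah'; rewrite /comm_mx -!repr_mxM // (centsP abA).
exists P, (fun j h => (P *m rG h *m invmx P) j j); split=> // j h Ah.
have /diagonalizable_forPex[D /(simmxP uP) E] : diagonalizable_for P (rG h).
  by apply: Pdiag; rewrite map_f // mem_enum.
rewrite -row_mul E mulmxK // row_mul row_diag_mx -scalemxAl -rowE.
by rewrite mxE eqxx mulr1n.
Qed.

Variables (P : 'M[K]_#|A|) (chi : 'I_#|A| -> gT -> K).
Local Notation rA := (regular_repr K A).
Hypothesis uP : P \in unitmx.
Hypothesis chiP : forall j h, h \in A -> row j P *m rA h = chi j h *: row j P.

Lemma eigen_row_inj j : injective (fun c => c *: row j P).
Proof.
move=> c d /eqP; rewrite -subr_eq0 -scalerBl scaler_eq0 subr_eq0 => /orP[/eqP//|].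
rewrite rowE => /eqP/(congr1 (mulmx^~ (invmx P))); rewrite mulmxK // mul0mx.
by move/rowP/(_ j); rewrite !mxE !eqxx => /eqP; rewrite oner_eq0.
Qed.

Lemma chi1 j : chi j 1%g = 1.
Proof. by apply: (@eigen_row_inj j); rewrite /= -chiP // repr_mx1 mulmx1 scale1r. Qed.

Lemma chiM j : {in A &, forall g h, chi j (g * h)%g = chi j g * chi j h}.
Proof.
move=> g h Ag Ah; apply: (@eigen_row_inj j).
by rewrite /= -chiP ?groupM // repr_mxM // mulmxA chiP // -scalemxAl chiP // scalerA.
Qed.

Lemma chiX j h i : h \in A -> chi j (h ^+ i)%g = chi j h ^+ i.
Proof.
move=> Ah; elim: i => [|i IHi]; first by rewrite expg0 chi1.
by rewrite expgS chiM ?groupX // IHi exprS.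
Qed.

Lemma chi_expq j h : h \in A -> chi j h ^+ q = 1.
Proof. by move=> Ah; rewrite -chiX // expA // chi1. Qed.

Lemma chi_neq0 j h : h \in A -> chi j h != 0.
Proof.
move=> Ah; apply/eqP => c0; have /eqP := chi_expq j Ah.
by rewrite c0 expr0n (gtn_eqF (prim_order_gt0 zetaP)) eq_sym oner_eq0.
Qed.

Lemma regular_eigenvector (theta : gT -> K) h (v := \row_i (theta (enum_val i))^-1) :
    {in A &, forall g g', theta (g * g')%g = theta g * theta g'} ->
    {in A, forall g, theta g != 0} -> h \in A ->
  v *m rA h = theta h *: v.
Proof.
move=> thM th0 Ah; apply/rowP => l; rewrite !mxE.
have [g Ag El] : exists2 g, g \in A & enum_val l = (g * h)%g.
  by exists (enum_val l * h^-1)%g; rewrite ?mulgKV // groupM ?groupV ?enum_valP.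
rewrite (bigD1 (gring_index A g)) //= big1 ?addr0 => [|i ig]; rewrite !mxE.
  rewrite gring_indexK // eqxx /= El thM // invfM mulrCA mulfV ?th0 // mulr1.
  by rewrite -El gring_valK eqxx mulr1.
rewrite eqxx /= (_ : l == _ = false) ?mulr0 //; apply: contraNF ig => /eqP E.
have Ei := enum_valP i; rewrite -(gring_valK i); apply/eqP; congr (gring_index A _).
by apply: (mulIg h); rewrite -El E gring_indexK ?groupM.
Qed.

(** The eigenvector of [regular_eigenvector] has a nonzero coordinate in the basis [P]; comparing
    eigenvalues there identifies the character. *)
Lemma eigenbasis_complete (theta : gT -> K) :
    {in A &, forall g g', theta (g * g')%g = theta g * theta g'} ->
    {in A, forall g, theta g != 0} ->
  exists j, {in A, chi j =1 theta}.
Proof.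
move=> thM th0; pose v : 'rV_#|A| := \row_i (theta (enum_val i))^-1.
pose d := v *m invmx P; have Ed : d *m P = v by rewrite mulmxKV.
have [j dj] : exists j, d 0 j != 0.
  apply/existsP; rewrite -negb_forall; apply/negP => /forallP d0.
  have v0 : v = 0.
    rewrite -Ed (_ : d = 0) ?mul0mx //; apply/rowP => j; rewrite [RHS]mxE.
    exact/eqP/d0.
  have /rowP/(_ (gring_index A 1)) /eqP := v0.
  by rewrite !mxE gring_indexK // invr_eq0 (negPf (th0 _ _)).
exists j => h Ah; apply: (mulfI dj).
have : (\row_l (d 0 l * chi l h)) *m P = (theta h *: d) *m P.
  rewrite -scalemxAl Ed -(regular_eigenvector thM th0 Ah) -/v -Ed -mulmxA.
  rewrite !mulmx_sum_row; apply: eq_bigr => l _.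
  by rewrite mxE -scalerA -chiP // row_mul.
move/(can_inj (mulmxK uP))/rowP/(_ j); rewrite !mxE => ->; exact: mulrC.
Qed.

(** Otherwise every [chi j c] would have order dividing [p ^ t], so [c ^+ (p ^ t)] would act
    trivially on the regular representation, which is faithful. *)
Lemma exists_faithful_chi p t c : prime p -> c \in A -> #[c]%g = (p ^ t.+1)%N ->
  exists j, #[c]%g.-primitive_root (chi j c).
Proof.
move=> pp Ac oc; apply/existsP; apply: contraT => /existsPn nc.
have chi_c j : chi j c ^+ (p ^ t) = 1.
  have c1 : chi j c ^+ #[c]%g = 1 by rewrite -chiX // expg_order chi1.
  have [r rP] := prim_order_exists (order_gt0 c) c1.
  rewrite oc => /(dvdn_pfactor _ _ pp)[s]; rewrite leq_eqVlt => /orP[/eqP->|st] Er.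
    by have := nc j; rewrite oc -Er rP.
  by apply/eqP; rewrite -(prim_order_dvd rP) Er dvdn_exp2l.
have : (c ^+ (p ^ t))%g = 1%g.
  apply/set1P; apply: (subsetP (regular_mx_faithful K A)).
  rewrite inE groupX //= mul1mx; apply/eqP.
  rewrite -[LHS](mulKmx uP) -[RHS](mulKmx uP); congr (_ *m _).
  apply/row_matrixP => j; rewrite row_mul chiP ?groupX // chiX // chi_c scale1r.
  by rewrite mulmx1.
move/eqP; rewrite -order_dvdn oc => /(dvdn_leq _); rewrite expn_gt0 prime_gt0 //.
by move/(_ isT); rewrite leq_exp2l ?prime_gt1 // ltnn.
Qed.
End Eigenbasis.

(** * An abelian normal subgroup with cyclic quotient *)

Section ClassTwo.
Local Open Scope group_scope.
Variables (G : finGroupType) (a b : G).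
Hypothesis genG : <<[set a; b]>> = [set: G].
Hypothesis class2 : nil_class [set: G] = 2.
Let c := [~ b, a].
Let m := #[c].

Lemma commutator_central g : commute c g.
Proof.
have : c \in 'Z([set: G]).
  have : ([set: G]^`(1) \subset 'Z([set: G])) by rewrite -nil_class2 class2.
  by move/subsetP; apply; rewrite mem_commg ?inE.
by case/centerP => _; apply; rewrite inE.
Qed.

Lemma mulg_ba i : b * a ^+ i = a ^+ i * (b * c ^+ i).
Proof.
have ba : b * a = a * b * c by rewrite /c -commgC.
elim: i => [|i IHi]; first by rewrite !expg0 mul1g mulg1.
have ca : c ^+ i * a = a * c ^+ i by apply/commute_sym/commuteX/commute_sym/commutator_central.
rewrite expgSr mulgA IHi -!mulgA ca [b * (a * _)]mulgA ba expgS !mulgA.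
by rewrite -!mulgA.
Qed.

Definition class2_gens : {set G} := [set b; c; a ^+ m].
Definition class2_abelian : {group G} := <<class2_gens>>%G.
Local Notation A := class2_abelian.

Lemma mem_class2_gens : [/\ b \in A, c \in A & a ^+ m \in A].
Proof. by split; apply: mem_gen; rewrite !inE eqxx ?orbT. Qed.

(** [c] is central, and [a ^+ m] commutes with [b] because their commutator is [c ^+ m = 1]. *)
Lemma class2_abelianP : abelian A.
Proof.
rewrite abelian_gen; apply/centsP => x xS y yS.
have ab : commute (a ^+ m) b by rewrite /commute mulg_ba /m expg_order mulg1.
have cc := commutator_central.
move: xS yS; rewrite !inE -!orbA => /or3P[]/eqP-> /or3P[]/eqP->;
  first [exact: commute_refl | exact: cc | exact/commute_sym/cc | exact: ab | exact/commute_sym/ab].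
Qed.

Lemma class2_norm : a \in 'N(A).
Proof.
have [Ab Ac Aa] := mem_class2_gens.
rewrite inE -genJ gen_subG; apply/subsetP => _ /imsetP[x xS ->].
move: xS; rewrite !inE -!orbA => /or3P[]/eqP->.
- by rewrite conjg_mulR groupM.
- by rewrite conjgE (commutator_central a) mulKg.
- by rewrite conjgE -expgSr expgS mulKg.
Qed.

Lemma class2_dvd i : a ^+ i \in A -> (m %| i)%N.
Proof.
have [Ab _ _] := mem_class2_gens.
move=> Ai; have := centsP class2_abelianP _ Ab _ Ai.
rewrite /commute mulg_ba => /mulgI; rewrite -[RHS]mulg1 => /mulgI ci.
by rewrite order_dvdn ci.
Qed.

Lemma class2_prod : <[a]> * A = [set: G].
Proof.
have [Ab _ _] := mem_class2_gens.
rewrite -norm_joinEl ?cycle_subG ?class2_norm //.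
apply/eqP; rewrite eqEsubset subsetT -genG gen_subG.
apply/subsetP => x; rewrite !inE => /orP[]/eqP->; apply: mem_gen; rewrite inE.
  by rewrite cycle_id.
by rewrite Ab orbT.
Qed.

Lemma class2_factor g : exists (i : 'I_m) h, h \in A /\ g = a ^+ i * h.
Proof.
have [_ _ Aa] := mem_class2_gens.
have := in_setT g; rewrite -class2_prod => /mulsgP[_ h /cycleP[i ->] Ah ->].
have im : (i %% m < m)%N by rewrite ltn_mod order_gt0.
exists (Ordinal im), ((a ^+ m) ^+ (i %/ m)%N * h); split; first exact: groupM (groupX _ Aa) Ah.
by rewrite mulgA -expgM -expgD /= addnC mulnC -divn_eq.
Qed.

(** The quotient by [A] is cyclic, generated by the image of [a], whose order is [m] by
    [class2_dvd]. *)
Lemma class2_card : (m * #|A|)%N = #|G|.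
Proof.
have [_ _ Aa] := mem_class2_gens.
have nA : [set: G] \subset 'N(A).
  by rewrite -class2_prod mul_subG ?normG // cycle_subG class2_norm.
rewrite -[RHS]cardsT -(Lagrange (subsetT A)) mulnC -card_quotient //; congr (_ * _)%N.
transitivity #[coset A a]; last first.
  by rewrite orderE -quotient_cycle ?class2_norm // -quotientMidr class2_prod.
apply/eqP; rewrite eqn_dvd; apply/andP; split.
  apply: class2_dvd; apply: coset_idr; first by rewrite groupX ?class2_norm.
  by rewrite morphX ?class2_norm // expg_order.
by rewrite order_dvdn -morphX ?class2_norm //= coset_id.
Qed.
End ClassTwo.

(** * The class two case and the theorem *)

Lemma commutator_order (G : finGroupType) (p e : nat) (a b : G) : prime p ->
    <<[set a; b]>>%g = [set: G] -> nil_class [set: G] = 2 ->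
    exponent [set: G] = (p ^ e)%N ->
  exists t, #[[~ b, a]]%g = (p ^ t.+1)%N.
Proof.
move=> pp genG class2 expG.
have : (#[[~ b, a]]%g %| p ^ e)%N by rewrite -expG dvdn_exponent ?inE.
case/(dvdn_pfactor _ _ pp) => -[|t] _ oc; last by exists t.
(* A trivial commutator would make the generators commute and the class at most 1. *)
have : (nil_class [set: G] <= 1)%N = abelian [set: G] := nil_class1 _.
rewrite class2 -genG abelian_gen => /esym/negP[].
have /eqP := oc; rewrite expn0 order_eq1 => /commgP ba.
apply/centsP => x + y; rewrite !inE => /orP[]/eqP-> /orP[]/eqP->;
  by [exact: commute_refl | exact: ba | exact/commute_sym/ba].
Qed.

Lemma noether_rational_class2 (K : fieldType) (G : finGroupType) (p e : nat)
    (a b : G) (zeta : K) : prime p ->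
    <<[set a; b]>>%g = [set: G] -> nil_class [set: G] = 2 ->
    exponent [set: G] = (p ^ e)%N -> (p ^ e).-primitive_root zeta ->
  rational_over (@noetherC K G : {rmorphism K -> noether_field K G}).
Proof.
move=> pp genG class2 expG zetaP.
have [t oc] := commutator_order pp genG class2 expG.
pose c := [~ b, a]%g; pose m := #[c]%g; pose A := class2_abelian a b.
have [Ab Ac Aa] : [/\ b \in A, c \in A & (a ^+ m)%g \in A] := mem_class2_gens a b.
have abA : abelian A := class2_abelianP a b class2.
have expg_q (g : G) : (g ^+ (p ^ e))%g = 1%g by rewrite -expG expg_exponent ?inE.
have expA : {in A, forall h, (h ^+ (p ^ e))%g = 1%g} by move=> h _; apply: expg_q.
have [P [chi [uP chiP]]] := repr_eigenbasis abA expA zetaP (regular_repr K A).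
have chiMA := chiM uP chiP; have chiXA := chiX uP chiP.
have chi0A := chi_neq0 expA zetaP uP chiP.
have [j1 wP] := exists_faithful_chi uP chiP pp Ac oc.
set w := chi j1 c in wP.
have nA : {in A, forall h, (h ^ a)%g \in A}.
  by move=> h Ah; rewrite memJ_norm // class2_norm.
(* The conjugate of [chi j1] by [a] is again a character of [A], hence occurs in the eigenbasis. *)
have [j0 chi0] : exists j, {in A, chi j =1 fun h => chi j1 (h ^ a)%g}.
  apply: (eigenbasis_complete uP chiP) => [g h Ag Ah|h Ah].
    by rewrite conjMg chiMA ?nA.
  by rewrite chi0A ?nA.
(* The exponent is chosen to be 1 whenever [chi j c = w], which covers [j0] and [j1]. *)
have /fin_all_exists2[kappa kappaP kappa1] j :
    exists2 r, chi j c = w ^+ r & chi j c = w -> r = 1%N.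
  have [->|ne] := eqVneq (chi j c) w; first by exists 1%N.
  have cm : chi j c ^+ m = 1 by rewrite -chiXA // expg_order (chi1 uP chiP).
  by have [i E] := prim_rootP wP cm; exists i => // Ew; case/eqP: ne.
have kap1 : kappa j1 = 1%N by apply: kappa1.
have ca : (c ^ a)%g = c by rewrite conjgE (commutator_central a b class2 a) mulKg.
have kap0 : kappa j0 = 1%N by apply: kappa1; rewrite chi0 // ca.
pose gamma j := chi j (a ^+ m)%g.
have gamma01 : gamma j0 = gamma j1.
  by rewrite /gamma chi0 // conjgE -expgSr expgS mulKg.
have me : (m %| p ^ e)%N by rewrite order_dvdn expg_q.
(* The quotient [gamma j / gamma j1 ^+ kappa j] has order dividing [p ^ e %/ m], so it is a power of
   [zeta ^+ m] and has an [m]-th root in [K]. At [j0] it is 1, and the root 1 is chosen. *)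
have /fin_all_exists2[xi xiP xi0] j :
    exists2 x, x ^+ m * gamma j1 ^+ kappa j = gamma j & j = j0 -> x = 1.
  have [->|ne] := eqVneq j j0.
    by exists 1; rewrite // expr1n mul1r kap0 gamma01.
  have root1 i : gamma i ^+ (p ^ e %/ m) = 1.
    by rewrite -chiXA // -expgM mulnC divnK // expg_q (chi1 uP chiP).
  have qm_dvd : (p ^ e %/ m %| p ^ e)%N by rewrite -{2}(divnK me) dvdn_mulr.
  have zmP := dvdn_prim_root zetaP qm_dvd.
  have s1 : (gamma j / gamma j1 ^+ kappa j) ^+ (p ^ e %/ m) = 1.
    by rewrite expr_div_n root1 -exprM mulnC exprM root1 expr1n divr1.
  have [i E] := prim_rootP zmP s1.
  exists (zeta ^+ i); last by move/eqP: ne.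
  rewrite -exprM -[LHS](_ : gamma j / gamma j1 ^+ kappa j * gamma j1 ^+ kappa j = _).
    by rewrite divfK // expf_neq0 // chi0A.
  rewrite E -exprM; congr (zeta ^+ _ * _); rewrite mulnC; congr (_ * _)%N.
  by rewrite -{1}(divnK me) mulKn // divn_gt0 ?order_gt0 // dvdn_leq // expn_gt0 prime_gt0.
have beta0 : chi j0 b = w * chi j1 b.
  by rewrite chi0 // conjg_mulR chiMA // mulrC.
have j01 : j0 != j1.
  (* Equality would force [w = 1], but [w] has order [m >= p]. *)
  apply/eqP => E; move/eqP: beta0; rewrite E -{1}[chi j1 b]mul1r.
  rewrite (inj_eq (mulIf (chi0A _ _ Ab))) eq_sym -[w]expr1 -(prim_order_dvd wP) dvdn1.
  by rewrite oc eqn_leq leqNgt (leq_trans (prime_gt1 pp)) // -{1}[p]expn1 leq_exp2l ?prime_gt1.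
pose e_ j : ratfun K #|G| :=
  lform (@ratfunC K #|G|) (fun i => noether_var K (enum_val i)) (row j P).
have act_e h j : h \in A -> noether_aut K h (e_ j) = ratfunC _ (chi j h) * e_ j.
  move=> Ah; rewrite /e_ -lformZ -chiP // lform_mul.
  apply: rmorph_lform => [d|i]; first exact: noether_actC.
  rewrite rowK lform_delta gring_indexK ?groupM ?enum_valP //.
  (* The regular representation translates on the right, the action on the left; they agree since
     [A] is abelian. *)
  by rewrite (centsP abA _ (enum_valP i) _ Ah); apply: noether_act_var.
have mK : m%:R != 0 :> K by rewrite (prim_root_natf_neq0 wP).
have act_b j i : noether_aut K b (translate (@noether_aut K G) a e_ j i) =
    ratfunC _ (chi j b * w ^+ (kappa j * i)) * translate (@noether_aut K G) a e_ j i.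
  rewrite /translate -noether_actM mulg_ba // noether_actM act_e ?groupM ?groupX //.
  rewrite rmorphM /= [X in X * _]noether_actC chiMA ?groupX // chiXA // kappaP.
  by rewrite exprM.
have z_per j i : translate (@noether_aut K G) a e_ j (i + m) =
    ratfunC _ (gamma j) * translate (@noether_aut K G) a e_ j i.
  by rewrite /translate expgD noether_actM act_e // rmorphM /= [X in X * _]noether_actC.
have X_z h : noether_var K h \in adj (consts (@ratfunC K #|G|))
    [seq translate (@noether_aut K G) a e_ u.1 u.2 | u : 'I_#|A| * 'I_m].
  (* The variable of [h] is the translate by [a ^+ i] of that of [h'] in [A], which is expanded in
     the eigenbasis. *)
  have [i [h' [Ah' ->]]] := class2_factor genG class2 h.
  rewrite -noether_act_var -{1}[h'](gring_indexK h' Ah').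
  rewrite -(lform_delta (@ratfunC K #|G|) (fun i => noether_var K (enum_val i))).
  rewrite -[delta_mx _ _](mulmxKV uP) lform_mul rmorph_sum rpred_sum // => j _.
  rewrite rmorphM /= noether_actC rpredM //; first exact/adj_base/iota_consts.
  by apply: adj_mem; apply/mapP; exists (j, i); rewrite ?mem_enum.
have cG := class2_card genG class2.
have [s [ss sfix sgen]] := monomial_fixed (@noether_act1 K G) (@noether_actM K G)
  (@noether_actC K G) (@noether_indep K G) genG wP mK cG act_b z_per X_z xiP j01
  kap1 kap0 (xi0 _ erefl) beta0.
apply: (noether_rational ss sfix) => f ffix.
by apply: sgen => // u Xu; apply: noether_full.
Qed.

Local Close Scope ring_scope.

Theorem theorem4p6 (p n e : nat) (G : finGroupType) (K : fieldType) :
  prime p -> 3 <= n ->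
  (exists x y : G, <<[set x; y]>>%g = [set: G]) ->
  #|[set: G]| = p ^ n ->
  nil_class [set: G] = 2 ->
  exponent [set: G] = p ^ e ->
  p \in [pchar K]%R \/
    (p \notin [pchar K]%R /\ exists z : K, (p ^ e).-primitive_root%R z) ->
  rational_over (@noetherC K G : {rmorphism K -> noether_field K G}).
Proof.
move=> pp _ [x [y genG]] cardG class2 expG [charK|[_ [z zP]]].
  by apply: (noether_rational_pchar charK); rewrite /pgroup cardG pnatX pnat_id.
exact: noether_rational_class2 pp genG class2 expG zP.
Qed.
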